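(* Let $R(z)$ be a rational function of degree $n$ whose poles do not belong to the segment $I=[-1,1]$, and let $\omega(x)=1/\sqrt{1-x^2}$. Put $$\mathcal R(z):=R_1(z)\cdot\overline{R_1(1/\overline z)},\qquad R_1(z):=R\left(\tfrac12(z+1/z)\right).$$ Denote by $z_k$, $k=1,\dots,\nu$, all pairwise distinct poles of the function $\mathcal R$ which lie in the disc $|z|<1$, and by $n_k$ their multiplicities. Set $$B_0(z)=\prod_{k=1}^{\nu}\left(\frac{z-z_k}{1-z\overline{z_k}}\right)^{n_k},\qquad \mu_0(z)=\sum_{k=1}^{\nu}\frac{n_k(1-|z_k|^2)}{|z-z_k|^2},\qquad \sum_{k=1}^{\nu}n_k=2n.$$ Then for any $\varphi\in\mathbb R$ we have $$\int_I R(x)\omega(x)\,dx=\pi\sum_{k=1}^{2n+1}\frac{R(x_k(\varphi))}{\mu_0(\zeta_k(\varphi))+1},\qquad x_k=\frac12\left(\zeta_k+\frac1{\zeta_k}\right)\in[-1,1],$$ where the notches $\zeta_k=\zeta_k(\varphi)$ are the roots of the equation $\zeta B_0(\zeta)=e^{i\varphi}$; and $$\|R\|_{L^{2m}(I;\,\omega)}^{2m}:=\int_I|R(x)|^{2m}\omega(x)\,dx=\pi\sum_{k=1}^{2nm+1}\frac{|R(x_k(m,\varphi))|^{2m}}{m\mu_0(\zeta_k(m,\varphi))+1},\qquad m\in\mathbb N,$$ where the notches $\zeta_k(m,\varphi)$ are the roots of the equation $\zeta B_0^m(\zeta)=e^{i\varphi}$ and $x_k(m,\varphi)=\frac12\l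eft(\zeta_k(m,\varphi)+1/\zeta_k(m,\varphi)\right)$.
   Context: The degree of a rational function is the number of its poles in $\overline{\mathbb C}=\mathbb C\cup\{\infty\}$ counted with multiplicity.
   Formalization: The equality that the multiplicities n_k sum to 2n is taken as a hypothesis (no pole of R cancels with a zero of its conjugate function); it fails in general, e.g. for R(z)=(z-2i)/(z+2i), where the product function is 1 and the quadrature formula is false. *)

(* Defs.v *)
From HB Require Import structures.
From mathcomp Require Import all_boot all_order all_algebra.
From mathcomp Require Import complex.
From mathcomp Require Import all_classical all_reals all_analysis.

Set Implicit Arguments.
Unset Strict Implicit.
Unset Printing Implicit Defensive.

Import Order.TTheory GRing.Theory Num.Theory.

Local Open Scope classical_set_scope.
Local Open Scope complex_scope.
Local Open Scope ring_scope.

Section RationalFunctions.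
Variable R : realType.
Local Notation C := R[i].
Implicit Types (f : C -> C) (a z w : C) (n k : nat).

(* The values of a rational function at its poles are left arbitrary. *)
Definition ratfun f :=
  exists p q : {poly C}, [/\ coprimep p q, q != 0 &
    forall z, q.[z] != 0 -> f z = p.[z] / q.[z]].

(* f(z) = (z - a)^-k * g(z) with g rational and finite at a, and g(a) != 0
   unless k = 0; thus k = 0 means that a is not a pole.  The equality is
   required off a finite set only, so that neither the arbitrary values at
   poles nor the convention 0^-1 = 0 matters. *)
Definition pole_mult f a k :=
  exists (p q : {poly C}) (s : seq C),
    [/\ q.[a] != 0, (0 < k)%N -> p.[a] != 0 &
        forall z, z \notin s -> f z = p.[z] / ((z - a) ^+ k * q.[z])].

Definition pole_order f a : nat := xget 0%N [set k | pole_mult f a k].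

(* The pole at infinity of f is the pole at 0 of z |-> f(1/z). *)
Definition pole_order_infty f : nat := pole_order (fun z => f z^-1) 0.

Definition ratdegree f : nat :=
  ((\big[addn/0%N]_(a \in [set: C]) pole_order f a) + pole_order_infty f)%N.

Definition joukowski z : C := (z + z^-1) / 2%:R.

Definition ratR1 f z : C := f (joukowski z).

(* Zeros of one factor may cancel poles of the other one: for
   f(z) = (z - 2i) / (z + 2i) this product is 1. *)
Definition calR f z : C := ratR1 f z * (ratR1 f (z^*)^-1)^*.

Definition blaschke0 (nu : nat) (z_ : 'I_nu -> C) (n_ : 'I_nu -> nat) w : C :=
  \prod_(k < nu) ((w - z_ k) / (1 - w * (z_ k)^*)) ^+ n_ k.

Definition mu0 (nu : nat) (z_ : 'I_nu -> C) (n_ : 'I_nu -> nat) w : R :=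
  \sum_(k < nu) (n_ k)%:R * (1 - Normc.normc (z_ k) ^+ 2)
                / Normc.normc (w - z_ k) ^+ 2.

Definition expi (phi : R) : C := cos phi +i* sin phi.

(* zeta lists the complex roots of w * B(w) = e^(i phi), without repetition. *)
Definition roots_of_eq (B : C -> C) (phi : R) (zeta : seq C) :=
  uniq zeta /\ forall w, w \in zeta <-> w * B w = expi phi.

End RationalFunctions.

Section Integrals.
Variable R : realType.
Implicit Types (D : set R) (g : R -> R[i]).
Local Notation leb := (@lebesgue_measure R).

Definition omega (x : R) : R := (Num.sqrt (1 - x ^+ 2))^-1.

Definition cintegrable D g :=
  leb.-integrable D (fun x => (complex.Re (g x))%:E) /\
  leb.-integrable D (fun x => (complex.Im (g x))%:E).

Definition cintegral D g : R[i] :=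
  (\int[leb]_(x in D) complex.Re (g x)) +i*
  (\int[leb]_(x in D) complex.Im (g x)).

End Integrals.

(* Main.v *)
(* On |z| = 1 one has (z + 1/z)/2 = Re z, so z |-> f((z + 1/z)/2) is a rational
   function there.  Write S for the product of the (z - z_k)^n_k and D for that
   of the (1 - z conj(z_k))^n_k, and f = p/q with p, q of degree at most n.  With
   J z = (z + 1/z)/2, the polynomial T = z^(2n) q(J z) conj(q)(J z) has degree at
   most 4n, is its own conjugate reciprocal, and is divisible by S (a pole of calR
   is a zero of T), hence by D.  As sum n_k = 2n leaves no room for a further
   factor, T = c S D, and f o J = M/(S D) with deg M <= 4n.  Likewise
   |f o J|^(2m) = M_m/(S D)^m on the circle, so a single quadrature suffices.

   Partial fractions give M/(S D) = u/S + v/D with deg u < deg S and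
   deg v <= deg S.  The mean over the circle is v(0), since v/D (in z) and u/S
   (in 1/z) are uniform limits of polynomials on the closed disc, and cos(j t) has
   mean 0 on [0, pi] for j > 0.  At the nodes, i.e. at the roots of
   W = z S - e D with |e| = 1, Lagrange interpolation of z u + e v at 0 gives the
   same value, because 1/(mu + 1) = e D/(z W') there. *)

Require Import Defs.
From HB Require Import structures.
From mathcomp Require Import all_boot all_order all_algebra.
From mathcomp Require Import complex.
From mathcomp Require Import all_classical all_reals all_analysis measurable_realfun.
From mathcomp Require Import zify ring lra.

Set Implicit Arguments.
Unset Strict Implicit.
Unset Printing Implicit Defensive.

Import Order.TTheory GRing.Theory Num.Theory.
Import numFieldNormedType.Exports.

Local Open Scope classical_set_scope.
Local Open Scope complex_scope.
Local Open Scope ring_scope.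

(** * The quadrature for rational functions of the circle *)

Section Lagrange.
Variable F : fieldType.
Implicit Types (p : {poly F}) (r : seq F).

Lemma horner_deriv_prod_rem r x : uniq r -> x \in r ->
  (\prod_(y <- r) ('X - y%:P))^`().[x] = (\prod_(y <- rem x r) ('X - y%:P)).[x].
Proof.
move=> ur xr; rewrite (perm_big _ (perm_to_rem xr)) big_cons derivM derivXsubC mul1r.
by rewrite hornerD hornerM hornerXsubC subrr mul0r addr0.
Qed.

(** The residues of p/(z w) sum to zero, the size bound leaving none at infinity. The proof
    evaluates at 0 the Lagrange interpolation of [p] at the nodes [r]. *)
Lemma sum_residues r p : uniq r -> 0 \notin r -> (size p <= size r)%N ->
  let w := \prod_(y <- r) ('X - y%:P) in
  \sum_(x <- r) p.[x] / (x * w^`().[x]) = - p.[0] / w.[0].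
Proof.
move=> ur r0 sp w.
pose L x := \prod_(y <- rem x r) ('X - y%:P).
have wL x : x \in r -> w = ('X - x%:P) * L x.
  by move=> xr; rewrite /w (perm_big _ (perm_to_rem xr)) big_cons.
have LE x : x \in r -> w^`().[x] = (L x).[x] by exact: horner_deriv_prod_rem.
have root_prod (s : seq F) y : root (\prod_(z <- s) ('X - z%:P)) y = (y \in s).
  exact: root_prod_XsubC.
have L0 x : x \in r -> (L x).[x] != 0.
  by move=> xr; rewrite -/(root _ _) root_prod mem_rem_uniqF.
have Ly x y : x \in r -> y \in r -> x != y -> (L x).[y] = 0.
  by move=> xr yr xy; apply/rootP; rewrite root_prod mem_rem_uniq// inE eq_sym xy.
have w0 : w.[0] != 0 by rewrite -/(root _ _) root_prod.
have pE : p = \sum_(x <- r) (p.[x] / w^`().[x]) *: L x.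
  apply/eqP; rewrite -subr_eq0; apply/eqP.
  (* The difference vanishes at all the nodes, while its size does not exceed their number. *)
  apply: (@roots_geq_poly_eq0 _ _ r) => //.
    apply/allP => y yr; apply/rootP; rewrite hornerD hornerN horner_sum.
    rewrite (big_rem y)//= hornerZ LE// divfK ?L0// big_seq big1 ?addr0 ?subrr// => x.
    rewrite mem_rem_uniq// inE => /andP[xy xr].
    by rewrite hornerZ Ly// mulr0.
  apply: leq_trans (size_polyD _ _) _; rewrite geq_max sp size_polyN /=.
  apply: leq_trans (size_sum _ _ _) _; apply/bigmax_leqP_seq => x xr _.
  apply: leq_trans (size_scale_leq _ _) _.
  rewrite size_prod_XsubC size_rem// prednK//.
  by case: (r) xr.
rewrite {2}pE horner_sum mulNr mulr_suml -sumrN !big_seq.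
apply: eq_bigr => x xr; rewrite hornerZ LE// (wL x xr).
rewrite hornerM hornerXsubC sub0r.
have x0 : x != 0 by apply: contraNneq r0 => <-.
have Lx0 : (L x).[0] != 0.
  by apply: contraNneq w0; rewrite (wL x xr) hornerM => ->; rewrite mulr0.
by field; rewrite Lx0 oppr_eq0 x0 L0.
Qed.

Lemma horner_deriv_prod (I : Type) (s : seq I) (f : I -> {poly F}) x :
  all (fun i => (f i).[x] != 0) s ->
  (\prod_(i <- s) f i)^`().[x] =
  (\prod_(i <- s) f i).[x] * \sum_(i <- s) (f i)^`().[x] / (f i).[x].
Proof.
elim: s => [|i s IH] /=; first by rewrite !big_nil derivC horner0 mulr0.
move=> /andP[fi /IH {}IH]; rewrite !big_cons derivM hornerD !hornerM IH.
by field.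
Qed.

End Lagrange.

(** * Blaschke products and the nodes on the unit circle *)

Section Blaschke.
Variable C : numClosedFieldType.
Implicit Types (s : seq C) (a w e : C) (u v : {poly C}).

(** Multiplicities are encoded by repetition in [s]. The quotient of [blaschke_num] by
    [blaschke_den] is the Blaschke product; on the unit circle [poisson_sum] is a sum of Poisson
    kernels. *)
Definition blaschke_num s := \prod_(a <- s) ('X - a%:P).
Definition blaschke_den s := \prod_(a <- s) (1 - a^* *: 'X).
Definition poisson_sum s w := \sum_(a <- s) (1 - `|a| ^+ 2) / `|w - a| ^+ 2.

Lemma horner_blaschke_num s w : (blaschke_num s).[w] = \prod_(a <- s) (w - a).
Proof. by rewrite horner_prod; apply: eq_bigr => a _; rewrite !hornerE. Qed.

Lemma horner_blaschke_den s w : (blaschke_den s).[w] = \prod_(a <- s) (1 - w * a^*).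
Proof. by rewrite horner_prod; apply: eq_bigr => a _; rewrite !hornerE mulrC. Qed.

Lemma size_blaschke_num s : size (blaschke_num s) = (size s).+1.
Proof. exact: size_prod_XsubC. Qed.

Lemma size_blaschke_den s : (size (blaschke_den s) <= (size s).+1)%N.
Proof.
rewrite /blaschke_den; elim: s => [|a s IH]; first by rewrite big_nil size_poly1.
rewrite big_cons mulrBl mul1r.
apply: leq_trans (size_polyD _ _) _; rewrite geq_max (leq_trans IH)//=.
rewrite size_polyN -scalerAl (leq_trans (size_scale_leq _ _))//.
by rewrite mulrC (leq_trans (size_polyMleq _ _))// size_polyX addn2.
Qed.

Lemma blaschke_den0 s : (blaschke_den s).[0] = 1.
Proof. by rewrite horner_blaschke_den big1// => a _; rewrite mul0r subr0. Qed.

(** For |a| < 1 the sign of the right-hand side decides whether a Blaschke factor has modulus below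
    or above 1 at [w]. *)
Lemma blaschke_norm_identity a w :
  `|1 - w * a^*| ^+ 2 - `|w - a| ^+ 2 = (1 - `|w| ^+ 2) * (1 - `|a| ^+ 2).
Proof. by rewrite !normCK !rmorphB rmorph1 rmorphM/= conjCK; ring. Qed.

Section InDisc.
Variable s : seq C.
Hypothesis s_disc : {in s, forall a, `|a| < 1}.

Lemma disc_sqr_gt0 a : a \in s -> 0 < 1 - `|a| ^+ 2.
Proof. by move=> /s_disc a1; rewrite subr_gt0 expr_lt1. Qed.

Lemma blaschke_den_neq0 w : `|w| <= 1 -> (blaschke_den s).[w] != 0.
Proof.
move=> w1; rewrite horner_blaschke_den prodf_seq_neq0; apply/allP => a as_ /=.
rewrite subr_eq0 eq_sym; apply: contraTneq (s_disc as_) => /(congr1 Num.norm).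
rewrite normrM norm_conjC normr1 => wa1; rewrite le_gtF//.
by rewrite -wa1 -[leRHS]mul1r ler_wpM2r.
Qed.

Lemma blaschke_num_neq0 w : 1 <= `|w| -> (blaschke_num s).[w] != 0.
Proof.
move=> w1; rewrite horner_blaschke_num prodf_seq_neq0; apply/allP => a as_ /=.
by rewrite subr_eq0; apply: contraTneq (s_disc as_) => <-; rewrite le_gtF.
Qed.

Lemma blaschke_le w : `|w| <= 1 -> `|(blaschke_num s).[w]| <= `|(blaschke_den s).[w]|.
Proof.
move=> w1; rewrite horner_blaschke_num horner_blaschke_den !normr_prod !big_seq.
apply: ler_prod => a as_; rewrite normr_ge0/=.
rewrite -(@ler_pXn2r _ 2)// ?nnegrE// -subr_ge0 blaschke_norm_identity.
by rewrite mulr_ge0 ?(ltW (disc_sqr_gt0 as_))// subr_ge0 expr_le1.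
Qed.

Lemma blaschke_ge w : 1 <= `|w| -> `|(blaschke_den s).[w]| <= `|(blaschke_num s).[w]|.
Proof.
move=> w1; rewrite horner_blaschke_num horner_blaschke_den !normr_prod !big_seq.
apply: ler_prod => a as_; rewrite normr_ge0/=.
rewrite -(@ler_pXn2r _ 2)// ?nnegrE// -subr_le0 blaschke_norm_identity.
by rewrite mulr_le0_ge0 ?(ltW (disc_sqr_gt0 as_))// subr_le0 expr_ge1.
Qed.

Lemma blaschke_coprime : coprimep (blaschke_num s) (blaschke_den s).
Proof.
apply/Pdiv.ClosedField.coprimepP => x; rewrite root_prod_XsubC => xs.
by apply: blaschke_den_neq0; rewrite ltW ?s_disc.
Qed.

Lemma poisson_sum_ge0 w : 0 <= poisson_sum s w.
Proof.
rewrite /poisson_sum big_seq sumr_ge0// => a as_.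
by rewrite divr_ge0 ?exprn_ge0// ltW ?disc_sqr_gt0.
Qed.

Variable e : C.
Hypothesis e_unit : `|e| = 1.

(** The equation z B(z) = e with its denominator cleared. *)
Definition node_poly := 'X * blaschke_num s - e *: blaschke_den s.

Lemma size_node_poly_aux : (size (e *: blaschke_den s)%R < size ('X * blaschke_num s)%R)%N.
Proof.
rewrite mulrC size_mulX ?size_blaschke_num; last by rewrite -size_poly_gt0 size_blaschke_num.
by rewrite ltnS (leq_trans (size_scale_leq _ _))// size_blaschke_den.
Qed.

Lemma size_node_poly : size node_poly = (size s).+2.
Proof.
rewrite size_polyDl ?size_polyN ?size_node_poly_aux// mulrC size_mulX ?size_blaschke_num//.
by rewrite -size_poly_gt0 size_blaschke_num.
Qed.

Lemma monic_node_poly : node_poly \is monic.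
Proof.
rewrite monicE lead_coefDl ?size_polyN ?size_node_poly_aux//.
by rewrite mulrC lead_coefMX -monicE monic_prod_XsubC.
Qed.

Lemma root_node_poly w :
  root node_poly w = (w * (blaschke_num s).[w] == e * (blaschke_den s).[w]).
Proof. by rewrite rootE !hornerE subr_eq0. Qed.

(** A root satisfies |w| |S(w)| = |D(w)|. Inside the disc |S| <= |D| and |w| < 1 make the left side
    too small; outside both inequalities reverse. *)
Lemma norm_root_node_poly w : root node_poly w -> `|w| = 1.
Proof.
rewrite root_node_poly => /eqP /(congr1 Num.norm); rewrite !normrM e_unit mul1r => E.
have [w1|w1|//] := real_ltgtP (normr_real w) (real1 C).
  have D0 : 0 < `|(blaschke_den s).[w]| by rewrite normr_gt0 blaschke_den_neq0 ?ltW.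
  suff : `|w| * `|(blaschke_num s).[w]| < `|(blaschke_den s).[w]| by rewrite E ltxx.
  apply: (@le_lt_trans _ _ (`|w| * `|(blaschke_den s).[w]|)).
    by apply: ler_wpM2l => //; exact/blaschke_le/ltW.
  by rewrite gtr_pMl.
have D0 : 0 < `|(blaschke_num s).[w]| by rewrite normr_gt0 blaschke_num_neq0 ?ltW.
suff : `|(blaschke_den s).[w]| < `|w| * `|(blaschke_num s).[w]| by rewrite E ltxx.
apply: (@le_lt_trans _ _ (`|(blaschke_num s).[w]|)); first exact/blaschke_ge/ltW.
by rewrite ltr_pMl.
Qed.

(* Turns the weight 1/(mu0 + 1) into the Lagrange weight e D(w)/(w W'(w)). *)
Lemma deriv_node_poly w : root node_poly w ->
  w * node_poly^`().[w] = e * (blaschke_den s).[w] * (poisson_sum s w + 1).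
Proof.
move=> rw; have w1 := norm_root_node_poly rw.
have wn0 : w != 0 by rewrite -normr_gt0 w1.
have wJ : w * w^* = 1 by rewrite -normCK w1 expr1n.
have wa a : a \in s -> w - a != 0.
  by move=> /s_disc a1; rewrite subr_eq0; apply: contraTneq a1 => <-; rewrite w1 ltxx.
have wa' a : a \in s -> 1 - a^* * w != 0.
  move=> as_; have -> : 1 - a^* * w = w * (w - a)^*.
    by rewrite rmorphB/= mulrBr wJ [w * a^*]mulrC.
  by rewrite mulf_neq0// conjC_eq0 wa.
rewrite derivB derivM derivX derivZ mul1r !hornerE.
rewrite [_^`().[w]]horner_deriv_prod; last by apply/allP => a /wa; rewrite !hornerE.
rewrite [(blaschke_den s)^`().[w]]horner_deriv_prod; last first.
  by apply/allP => a /wa'; rewrite !hornerE.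
rewrite -/(blaschke_num s) -/(blaschke_den s).
have := rw; rewrite root_node_poly => /eqP E.
set sn := \sum_(a <- s) ('X - a%:P)^`().[w] / _.
set sd := \sum_(a <- s) (1 - a^* *: 'X)^`().[w] / _.
(* On the circle conj(w) = 1/w, so the Poisson sum is w times the logarithmic derivative of S/D. *)
have -> : poisson_sum s w = w * sn - w * sd.
  rewrite -mulrBr -sumrB mulr_sumr; apply: eq_big_seq => a as_.
  rewrite derivXsubC derivB derivC derivZ derivX sub0r !hornerE normCK normCK.
  have wa0 := wa _ as_; have wa0' := wa' _ as_.
  have -> : (w - a) * (w - a)^* = (w - a) * (1 - a^* * w) / w.
    rewrite rmorphB/= -mulrA; congr (_ * _); apply: (mulfI wn0).
    by rewrite mulrBr wJ [RHS]mulrC divfK// mulrC.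
  by field; rewrite wn0 wa0' wa0.
set S := (blaschke_num s).[w]; set D := (blaschke_den s).[w].
transitivity (w * S * (1 + w * sn) - e * D * (w * sd)); first by rewrite /S /D; ring.
by rewrite /S E -/D; ring.
Qed.

End InDisc.
End Blaschke.

Lemma not_uniq_mem_rem (T : eqType) (r : seq T) :
  ~~ uniq r -> exists2 x, x \in r & x \in rem x r.
Proof.
elim: r => [//|y r IH] /=; rewrite negb_and negbK.
have [yr _|yr /= /IH [x xr xrr]] := boolP (y \in r).
  by exists y; rewrite ?mem_head ?eqxx.
exists x; rewrite ?inE ?xr ?orbT//.
have /negbTE -> : y != x by apply: contraNneq yr => ->.
by rewrite inE xrr orbT.
Qed.

(** * Simplicity of the nodes and the discrete mean value formula *)

Section Quadrature.
Variables (C : numClosedFieldType) (s : seq C) (e : C).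
Hypothesis s_disc : {in s, forall a, `|a| < 1}.
Hypothesis e_unit : `|e| = 1.

(** At a multiple root the derivative of W would vanish, whereas [deriv_node_poly] makes w W'(w) a
    product of nonzero factors, the Poisson sum being nonnegative. *)
Lemma node_poly_roots : exists r : seq C,
  [/\ uniq r, size r = (size s).+1 & node_poly s e = \prod_(x <- r) ('X - x%:P)].
Proof.
have [r rE] := closed_field_poly_normal (node_poly s e).
rewrite (monicP (monic_node_poly s e)) scale1r in rE.
exists r; split=> //; last first.
  by apply: succn_inj; rewrite -(size_node_poly s e) rE size_prod_XsubC.
apply: contraT => /not_uniq_mem_rem [x xr xr'].
have rx : root (node_poly s e) x by rewrite rE root_prod_XsubC.
have := deriv_node_poly s_disc e_unit rx.
have -> : (node_poly s e)^`().[x] = 0.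
  rewrite rE (perm_big _ (perm_to_rem xr)) big_cons derivM derivXsubC mul1r.
  rewrite hornerD hornerM hornerXsubC subrr mul0r addr0.
  by apply/rootP; rewrite root_prod_XsubC.
move/esym/eqP; rewrite mulr0 !mulf_eq0 -normr_eq0 e_unit oner_eq0 /=.
rewrite (negbTE (blaschke_den_neq0 s_disc _)) ?(norm_root_node_poly s_disc e_unit rx)//=.
by rewrite gt_eqF// ltr_wpDl ?poisson_sum_ge0.
Qed.

(** At a node S = e D/x, so the bracket is (x u + e v)/(e D); the weight e D/(x W') cancels this
    denominator and leaves the sum of [sum_residues]. *)
Lemma blaschke_quadrature (r : seq C) (u v : {poly C}) :
  uniq r -> node_poly s e = \prod_(x <- r) ('X - x%:P) ->
  (size u <= size s)%N -> (size v <= (size s).+1)%N ->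
  \sum_(x <- r) (u.[x] / (blaschke_num s).[x] + v.[x] / (blaschke_den s).[x])
     / (poisson_sum s x + 1) = v.[0].
Proof.
move=> ur rE su sv.
have rr x : x \in r -> root (node_poly s e) x by rewrite rE root_prod_XsubC.
have e0 : e != 0 by rewrite -normr_gt0 e_unit.
have sr : size r = (size s).+1.
  by apply: succn_inj; rewrite -(size_prod_XsubC r id) -rE size_node_poly.
have r0 : 0 \notin r.
  apply/negP => /rr /(norm_root_node_poly s_disc e_unit); rewrite normr0 => /eqP.
  by rewrite eq_sym oner_eq0.
have sp : (size ('X * u + e *: v)%R <= size r)%N.
  rewrite sr (leq_trans (size_polyD _ _))// geq_max mulrC.
  rewrite (leq_trans (size_polyMleq _ _)) ?size_polyX ?addn2//=.
  exact: leq_trans (size_scale_leq _ _) sv.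
transitivity (\sum_(x <- r) ('X * u + e *: v).[x] / (x * (node_poly s e)^`().[x])).
  apply: eq_big_seq => x xr; have rx := rr x xr.
  have x1 := norm_root_node_poly s_disc e_unit rx.
  have x0 : x != 0 by rewrite -normr_gt0 x1.
  have D0 : (blaschke_den s).[x] != 0 by rewrite blaschke_den_neq0// x1.
  have m0 : poisson_sum s x + 1 != 0.
    by rewrite gt_eqF// ltr_wpDl ?poisson_sum_ge0.
  rewrite (deriv_node_poly s_disc e_unit rx) !hornerE.
  have -> : (blaschke_num s).[x] = e * (blaschke_den s).[x] / x.
    by move: rx; rewrite root_node_poly => /eqP <-; rewrite mulrAC divff// mul1r.
  by field; rewrite x0 e0 D0 m0.
(* Since D(0) = 1, W(0) = -e and the sum is -(e v(0))/(-e). *)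
rewrite rE sum_residues// -rE !hornerE blaschke_den0.
by field.
Qed.

Lemma blaschke_partial_fraction (p : {poly C}) :
  (size p <= (size s).*2.+1)%N ->
  exists u v : {poly C}, [/\ (size u <= size s)%N, (size v <= (size s).+1)%N &
    p = u * blaschke_den s + v * blaschke_num s].
Proof.
move=> sp; have /Bezout_eq1_coprimepP [[a b] /= ab] := blaschke_coprime s_disc.
have S0 : blaschke_num s != 0 by rewrite -size_poly_gt0 size_blaschke_num.
(* Modulo S the Bezout coefficient [b] inverts D, so this [u] makes p - u D divisible by S. *)
pose u := (p * b) %% blaschke_num s.
have su : (size u <= size s)%N by rewrite -ltnS -(size_blaschke_num s) ltn_modp.
have /dvdpP [v vE] : blaschke_num s %| p - u * blaschke_den s.
  have -> : p - u * blaschke_den s =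
      p * a * blaschke_num s + (p * b - u) * blaschke_den s.
    by rewrite -{1}[p]mulr1 -ab; ring.
  rewrite dvdp_addr; last exact: dvdp_mull.
  apply: dvdp_mulr; rewrite /u {1}(divp_eq (p * b) (blaschke_num s)) addrK.
  exact: dvdp_mull.
exists u, v; split=> //; last by rewrite -vE addrC subrK.
have [->|v0] := eqVneq v 0; first by rewrite size_poly0.
rewrite -(leq_add2r (size s)).
have <- : size (v * blaschke_num s) = (size v + size s)%N.
  by rewrite size_mul// size_blaschke_num addnS.
rewrite -vE (leq_trans (size_polyD _ _))// geq_max size_polyN addSn addnn sp.
rewrite (leq_trans (size_polyMleq _ _))//.
have := leq_add su (size_blaschke_den s).
by rewrite addnS -subn1 leq_subLR addnn => /leqW.
Qed.

End Quadrature.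

(** * Conjugate reciprocal polynomials and the Joukowski map *)

Section ClosedPoly.
Variable F : closedFieldType.
Implicit Types (p q d : {poly F}) (s : seq F).

(** Multiplied by the product of the X - z over [s], the difference vanishes everywhere, but a
    nonzero polynomial over a closed field has a nonroot. *)
Lemma poly_eq_off p q s : (forall z, z \notin s -> p.[z] = q.[z]) -> p = q.
Proof.
move=> pq; apply/eqP; rewrite -subr_eq0.
have := monic_neq0 (monic_prod_XsubC s xpredT id); set d := \prod_(z <- s) _ => d0.
suff : (p - q) * d == 0 by rewrite mulf_eq0 (negbTE d0) orbF.
apply/negPn/negP => /closed_nonrootP [z]; apply/negP; rewrite negbK rootM root_prod_XsubC.
have [zs|/pq E] := boolP (z \in s); first by rewrite orbT.
by rewrite rootE hornerD hornerN E subrr eqxx.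
Qed.

Lemma nonroot_off d : d != 0 -> exists s : seq F, forall z, z \notin s -> d.[z] != 0.
Proof.
move=> d0; have [s dE] := closed_field_poly_normal d; exists s => z zs.
by rewrite -rootE dE rootZ ?lead_coef_eq0// root_prod_XsubC.
Qed.

Lemma prod_XsubC_exp_dvd (I : eqType) (s : seq I) (z_ : I -> F) (n_ : I -> nat) p :
  injective z_ -> uniq s -> {in s, forall i, ('X - (z_ i)%:P) ^+ n_ i %| p} ->
  \prod_(i <- s) ('X - (z_ i)%:P) ^+ n_ i %| p.
Proof.
move=> z_inj; elim: s => [|i s IH]; first by rewrite big_nil dvd1p.
move=> /= /andP[is_ us] sp; rewrite big_cons Gauss_dvdp; last first.
  apply/Pdiv.ClosedField.coprimepP => x; rewrite rootE horner_exp expf_eq0 => /andP[_].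
  rewrite !hornerE subr_eq0 => /eqP ->; rewrite horner_prod prodf_seq_neq0.
  apply/allP => j js /=; rewrite horner_exp !hornerE expf_neq0// subr_eq0.
  by apply: contraNneq is_ => /z_inj ->.
rewrite sp ?mem_head// IH// => j js; apply: sp.
by rewrite inE js orbT.
Qed.

End ClosedPoly.

Section RevPoly.
Variable F : fieldType.
Implicit Types (p : {poly F}) (N : nat).

(** The reciprocal z^N p(1/z) for a formal degree [N], which may exceed the degree of [p]. *)
Definition rev_poly N p : {poly F} := \poly_(i < N.+1) p`_(N - i).

Lemma size_rev_poly N p : (size (rev_poly N p) <= N.+1)%N.
Proof. exact: size_poly. Qed.

Lemma horner_rev_poly N p z : (size p <= N.+1)%N -> z != 0 ->
  (rev_poly N p).[z] = z ^+ N * p.[z^-1].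
Proof.
move=> sp z0; rewrite horner_poly (horner_coef_wide _ sp) mulr_sumr.
rewrite (reindex_inj rev_ord_inj) /=; apply: eq_bigr => i _.
have iN : (i <= N)%N by rewrite -ltnS.
rewrite subSS subKn// exprVn mulrCA; congr (_ * _).
have -> : z ^+ N = z ^+ (N - i) * z ^+ i by rewrite -exprD subnK.
by rewrite mulfK// expf_neq0.
Qed.

Lemma rev_poly_at0 N p : (rev_poly N p).[0] = p`_N.
Proof. by rewrite horner_coef0 coef_poly subn0. Qed.

End RevPoly.

Section ConjJoukowski.
Variable C : numClosedFieldType.
Implicit Types (p q : {poly C}) (z w : C) (N : nat).

Definition conj_poly p : {poly C} := map_poly Num.conj p.

Lemma horner_conj_poly p z : (conj_poly p).[z] = (p.[z^*])^*.
Proof. by rewrite -[z in LHS]conjCK horner_map. Qed.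

Lemma size_conj_poly p : size (conj_poly p) = size p.
Proof. exact: size_map_poly. Qed.

Lemma conj_poly_eq0 p : (conj_poly p == 0) = (p == 0).
Proof. exact: map_poly_eq0. Qed.

(** This is z^N p((z + 1/z)/2), expanded without inverses so as to be a polynomial in z. *)
Definition jpoly N p : {poly C} :=
  \sum_(i < N.+1) p`_i *: ((2^-1 *: ('X^2 + 1)) ^+ i * 'X^(N - i)).

Lemma horner_jpoly N p z : (size p <= N.+1)%N -> z != 0 ->
  (jpoly N p).[z] = z ^+ N * p.[(z + z^-1) / 2].
Proof.
move=> sp z0; rewrite horner_sum (horner_coef_wide _ sp) mulr_sumr.
apply: eq_bigr => i _; have iN : (i <= N)%N by rewrite -ltnS.
rewrite hornerZ hornerM hornerXn horner_exp [RHS]mulrCA; congr (_ * _).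
have -> : z ^+ N = z ^+ (N - i) * z ^+ i by rewrite -exprD subnK.
rewrite -mulrA -exprMn mulrC; congr (_ * _ ^+ _).
by rewrite !hornerE /= [z * (_ + _)]mulrDr divff// mulrC expr2.
Qed.

Lemma size_jpoly N p : (size (jpoly N p) <= N.*2.+1)%N.
Proof.
apply: leq_trans (size_sum _ _ _) _; apply/bigmax_leqP => i _.
have iN : (i <= N)%N by rewrite -ltnS.
apply: leq_trans (size_scale_leq _ _) _; apply: leq_trans (size_polyMleq _ _) _.
rewrite size_polyXn addnS /=.
have s2 : (size (2^-1 *: ('X^2 + 1) : {poly C})%R <= 3)%N.
  apply: leq_trans (size_scale_leq _ _) _.
  by rewrite size_XnaddC.
have se (q : {poly C}) : (size q <= 3)%N -> (size (q ^+ i) <= (2 * i).+1)%N.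
  move=> s3; apply: leq_trans (size_poly_exp_leq _ _) _; rewrite ltnS leq_mul2r.
  by move: s3; case: (size q) => [|k] /= s3; rewrite ?[(k <= 2)%N]s3 orbT.
by have := se _ s2; set m := size _ => mi; clearbody m; move: mi iN; lia.
Qed.

(** The roots of z^2 - 2 w z + 1 have product 1 and sum 2 w. *)
Lemma joukowski_surj w : exists2 z : C, z != 0 & (z + z^-1) / 2 = w.
Proof.
have zz : (w + sqrtC (w ^+ 2 - 1)) * (w - sqrtC (w ^+ 2 - 1)) = 1.
  by rewrite mulrC -subr_sqr sqrtCK subKr.
exists (w + sqrtC (w ^+ 2 - 1)).
  by apply: contra_eqN zz => /eqP ->; rewrite mul0r eq_sym oner_eq0.
rewrite (mulr1_eq zz).
by apply: (mulIf (_ : (2 : C) != 0)); rewrite ?pnatr_eq0// divfK ?pnatr_eq0//; ring.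
Qed.

End ConjJoukowski.

(** * Factorization of self-reciprocal polynomials by Blaschke denominators *)

Section CircleFactorization.
Variable C : numClosedFieldType.
Implicit Types (p q t : {poly C}) (s : seq C) (z : C).

Definition star_poly N p : {poly C} := conj_poly (rev_poly N p).

Lemma size_star_poly N p : (size (star_poly N p) <= N.+1)%N.
Proof. by rewrite size_conj_poly size_rev_poly. Qed.

Lemma horner_star_poly N p z : (size p <= N.+1)%N -> z != 0 ->
  (star_poly N p).[z] = z ^+ N * (p.[(z^*)^-1])^*.
Proof.
move=> sp z0; rewrite horner_conj_poly horner_rev_poly ?conjC_eq0//.
by rewrite rmorphM rmorphXn/= conjCK.
Qed.

Lemma star_polyM M N p q : (size p <= M.+1)%N -> (size q <= N.+1)%N ->
  star_poly (M + N) (p * q) = star_poly M p * star_poly N q.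
Proof.
move=> sp sq; apply: (@poly_eq_off _ _ _ [:: 0]) => z; rewrite inE => z0.
rewrite hornerM !horner_star_poly//.
  by rewrite hornerM rmorphM exprD mulrACA.
by apply: leq_trans (size_polyMleq _ _) _; move: sp sq; lia.
Qed.

Lemma star_blaschke_num s : star_poly (size s) (blaschke_num s) = blaschke_den s.
Proof.
apply: (@poly_eq_off _ _ _ [:: 0]) => z; rewrite inE => z0.
rewrite horner_star_poly ?size_blaschke_num// horner_blaschke_num horner_blaschke_den.
rewrite rmorph_prod -(iter_mulr_1 (size s) z) -(count_predT s) -big_const_seq -big_split/=.
apply: eq_bigr => a _.
by rewrite rmorphB fmorphV/= conjCK mulrBr divff.
Qed.

(** The Joukowski map is invariant under inversion and commutes with conjugation, and [t] has real
    coefficients. *)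
Lemma star_jpoly N t : (size t <= N.+1)%N -> conj_poly t = t ->
  star_poly N.*2 (jpoly N t) = jpoly N t.
Proof.
move=> st tJ; apply: (@poly_eq_off _ _ _ [:: 0]) => z; rewrite inE => z0.
have zJ0 : z^* != 0 by rewrite conjC_eq0.
rewrite horner_star_poly ?size_jpoly// !horner_jpoly ?invr_eq0// rmorphM.
rewrite rmorphXn fmorphV/= conjCK exprVn mulrA -addnn exprD mulfK ?expf_neq0//.
congr (_ * _); rewrite -{2}tJ horner_conj_poly invrK; congr (_.[_])^*.
by rewrite rmorphM rmorphD !fmorphV/= rmorph_nat addrC.
Qed.

Lemma jpoly_eq0 N t : (size t <= N.+1)%N -> (jpoly N t == 0) = (t == 0).
Proof.
move=> st; apply/idP/idP => [/eqP T0|/eqP ->]; last first.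
  by rewrite /jpoly big1// => i _; rewrite coef0 scale0r.
apply/negPn/negP => /closed_nonrootP [w]; rewrite rootE.
have [z z0 <-] := joukowski_surj w; apply/negP; rewrite negbK.
have := horner_jpoly st z0; rewrite T0 horner0 => /esym/eqP.
by rewrite mulf_eq0 expf_eq0 (negbTE z0) andbF.
Qed.

Lemma jpoly_blaschke_factor s t : {in s, forall a, `|a| < 1} ->
  (size t <= (size s).+1)%N -> conj_poly t = t -> t != 0 ->
  blaschke_num s %| jpoly (size s) t ->
  exists2 c, c != 0 & jpoly (size s) t = c *: (blaschke_num s * blaschke_den s).
Proof.
move=> s1 st tJ t0 /dvdpP [y yE].
have T0 : jpoly (size s) t != 0 by rewrite jpoly_eq0.
have y0 : y != 0 by apply: contraNneq T0 => y0; rewrite yE y0 mul0r.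
have S0 : blaschke_num s != 0 by rewrite -size_poly_gt0 size_blaschke_num.
have sy : (size y <= (size s).+1)%N.
  have := size_jpoly (size s) t; rewrite yE size_mul// size_blaschke_num.
  by rewrite addnS /= -addnn -addSn leq_add2r.
(* T = y S is its own conjugate reciprocal, hence also T = y' D with y' the
   reciprocal of y; as S and D are coprime, S divides y', whose degree does not
   exceed that of S. *)
have TE : jpoly (size s) t = star_poly (size s) y * blaschke_den s.
  by rewrite -(star_jpoly st tJ) yE -addnn star_polyM ?size_blaschke_num// star_blaschke_num.
have /dvdpP [c cE] : blaschke_num s %| star_poly (size s) y.
  rewrite -(Gauss_dvdpl _ (blaschke_coprime s1)) -TE yE; exact: dvdp_mull.
have c0 : c != 0 by apply: contraNneq T0 => c0; rewrite TE cE c0 !mul0r.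
have : size c == 1%N.
  rewrite eqn_leq size_poly_gt0 c0 andbT.
  have := size_star_poly (size s) y; rewrite cE size_mul// size_blaschke_num addnS /=.
  by rewrite -add1n leq_add2r.
move=> /size_poly1P [k k0 kE]; exists k => //.
by rewrite TE cE kE mul_polyC scalerAl.
Qed.

End CircleFactorization.

(** * Integration against 1/sqrt(1 - x^2) *)

(** Allows [f] to blow up at the endpoints: the fundamental theorem is applied on compact
    subintervals exhausting ]a, b[, then monotone convergence on one side meets the continuity of
    [F] on the other. *)
Lemma ge0_continuous_FTC2_oo (R : realType) (f F : R -> R) (a b : R) :
  a < b ->
  {in `]a, b[, forall x, 0 <= f x} ->
  {in `]a, b[, continuous f} ->
  {within `[a, b], continuous F} ->
  (forall x : R, x \in `]a, b[ -> is_derive x 1 F (f x)) ->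
  (\int[lebesgue_measure]_(x in `]a, b[) (f x)%:E = (F b - F a)%:E)%E.
Proof.
move=> ab f0 cf cF dF.
(* Starting at 3 ensures 2 c(n) < b - a, so that every subinterval is nondegenerate. *)
pose c n : R := (b - a) / n.+3%:R.
have ba0 : 0 < b - a by rewrite subr_gt0.
have c0 n : 0 < c n by rewrite divr_gt0.
have c2 n : c n + c n < b - a.
  rewrite /c -mulrDr -[ltRHS]mulr1 ltr_pM2l// -mulr2n -[_ *+ 2]mulr_natr mulrC.
  by rewrite ltr_pdivrMr// mul1r ltr_nat.
have cle m n : (m <= n)%N -> c n <= c m.
  by move=> mn; rewrite ler_pM2l// lef_pV2 ?posrE// ler_nat.
have ccvg : c n @[n --> \oo] --> (0 : R).
  rewrite -[X in _ --> X](mulr0 (b - a)); apply: cvgMr.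
  have := @cvg_harmonic R; rewrite -(cvg_shiftn 2)/=.
  by apply: cvg_trans; apply: near_eq_cvg; near=> n; rewrite addn2.
pose A n : set R := `[a + c n, b - c n]%classic.
have Asub n : A n `<=` `]a, b[%classic.
  move=> x; rewrite /A /= !in_itv/= => /andP[ax xb].
  by rewrite (lt_le_trans _ ax) ?ltrDl// (le_lt_trans xb)// gtrBl.
have Ain n x : A n x -> x \in `]a, b[ by move/(Asub n).
have AU : `]a, b[%classic = \bigcup_n A n.
  apply/seteqP; split=> [x|x [n _ /Asub //]].
  rewrite /= in_itv/= => /andP[ax xb].
  have d0 : 0 < Num.min (x - a) (b - x) by rewrite lt_min !subr_gt0 ax.
  have [n _ /(_ n (leqnn _))] : \forall n \near \oo, c n < Num.min (x - a) (b - x).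
    move/cvgr0_norm_lt: ccvg => /(_ _ d0); apply: filterS => n.
    by rewrite gtr0_norm.
  rewrite /= lt_min => /andP[h1 h2]; exists n => //.
  by rewrite /A /= in_itv/=; apply/andP; split; lra.
have Acont n : {within A n, continuous f}.
  apply: continuous_in_subspaceT => x xA; apply: cf; apply: (Ain n).
  by rewrite inE in xA.
have FA n : (\int[lebesgue_measure]_(x in A n) (f x)%:E
             = (F (b - c n) - F (a + c n))%:E)%E.
  have ltA : a + c n < b - c n by have := c2 n; lra.
  have dFA x : x \in `[a + c n, b - c n] -> is_derive x 1 F (f x).
    by move=> xA; apply: dF; apply: (Ain n).
  rewrite (@continuous_FTC2 _ f F)//; first exact: Acont.
    have dA x : x \in `[a + c n, b - c n] -> derivable F x 1.
      by move=> xA; case: (dFA x xA).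
    have [_ ? ?] := (continuous_within_itvP F ltA).1 (derivable_within_continuous dA).
    by split=> // x /subset_itv_oo_cc /dA.
  move=> x /subset_itv_oo_cc xA; rewrite derive1E.
  by have := dFA x xA => ?; rewrite derive_val.
have cvA : (\int[lebesgue_measure]_(x in A n) (f x)%:E)%E @[n --> \oo] -->
    (\int[lebesgue_measure]_(x in \bigcup_n A n) (f x)%:E)%E.
  apply: ge0_nondecreasing_set_cvg_integral.
  - move=> m n mn; rewrite subsetEset; apply: subset_itv; rewrite bnd_simp.
      by rewrite lerD2l cle.
    by rewrite lerD2l lerN2 cle.
  - by move=> n; exact: measurable_itv.
  - move=> n; apply/measurable_EFinP; apply: subspace_continuous_measurable_fun => //.
    exact: measurable_itv.
  - by move=> n x /Ain xab; rewrite lee_fin f0.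
rewrite -AU (funext FA) in cvA.
have [_ Fa Fb] := (continuous_within_itvP F ab).1 cF.
have cvF : (F (b - c n) - F (a + c n))%:E @[n --> \oo] --> (F b - F a)%:E.
  apply: cvg_EFin; first exact: nearW.
  apply: cvgB.
    apply: (cvg_at_leftP _ _ _).1 Fb _ _; split; first by move=> n; rewrite gtrBl.
    by rewrite -[X in _ --> X]subr0; apply: cvgB => //; exact: cvg_cst.
  apply: (cvg_at_rightP _ _ _).1 Fa _ _; split; first by move=> n; rewrite ltrDl.
  by rewrite -[X in _ --> X]addr0; apply: cvgD => //; exact: cvg_cst.
exact: (cvg_unique (@ereal_hausdorff R) cvA cvF).
Unshelve. all: by end_near. Qed.

Lemma omega_ge0 (R : realType) (x : R) : 0 <= omega x.
Proof. by rewrite /omega invr_ge0 sqrtr_ge0. Qed.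

(** An inverse of a continuous function on a segment is continuous; this includes the endpoints,
    where [acos] is not differentiable. *)
Lemma continuous_within_acos (R : realType) : {within `[-1, 1], continuous (@acos R)}.
Proof.
have := @segment_can_ge_continuous R 0 pi (@cos R) (@acos R) (pi_ge0 R).
rewrite cospi cos0; apply.
  by apply: continuous_subspaceT; exact: continuous_cos.
by move=> x xI; apply: cosK.
Qed.

Lemma sqrt_1Bsqr_gt0 (R : realType) (x : R) : -1 < x < 1 -> 0 < Num.sqrt (1 - x ^+ 2).
Proof. by move=> /andP[? ?]; rewrite sqrtr_gt0; nra. Qed.

Lemma continuous_omega (R : realType) (x : R) : -1 < x < 1 -> {for x, continuous (@omega R)}.
Proof.
move=> xI; apply: cvgV; first by rewrite gt_eqF ?sqrt_1Bsqr_gt0.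
apply: continuous_comp; last exact: sqrt_continuous.
by apply: cvgB; [exact: cvg_cst|exact: exprn_continuous].
Qed.

Lemma derive_sin_acos (R : realType) (j : nat) (x : R) : -1 < x < 1 ->
  is_derive x 1 (fun x => sin (j.+1%:R * acos x))
    (- (j.+1%:R * (cos (j.+1%:R * acos x) * omega x))).
Proof.
move=> xI.
have H := is_derive1_acos xI.
by apply: is_derive_eq; rewrite /omega /GRing.scale/=; ring.
Qed.

Lemma sin_mul_pi (R : realType) (j : nat) : sin (j%:R * pi : R) = 0.
Proof.
elim: j => [|j IH]; first by rewrite mul0r sin0.
by rewrite -natr1 mulrDl mul1r sinDpi IH oppr0.
Qed.

Lemma continuous_within_comp_acos (R : realType) (g : R -> R) (c : R) :
  continuous g -> {within `[-1, 1], continuous (fun x : R => g (c * acos x))}.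
Proof.
move=> cg x.
apply: (@cvg_comp _ _ _ (from_subspace (`[-1, 1]%classic : set R) (@acos R))
  (fun y => g (c * y)) _ (nbhs (acos x))).
  exact: continuous_within_acos.
apply: (@continuous_comp _ _ _ (fun y : R => c * y) g); last exact: cg.
exact: mulrl_continuous.
Qed.

Lemma measurable_cos_acos (R : realType) (j : nat) :
  measurable_fun (`[-1, 1]%classic : set R) (fun x : R => cos (j%:R * acos x)).
Proof.
apply: subspace_continuous_measurable_fun; first exact: measurable_itv.
by apply: continuous_within_comp_acos; exact: continuous_cos.
Qed.

Lemma measurable_omega (R : realType) : measurable_fun (`[-1, 1]%classic : set R) (@omega R).
Proof.
apply: (@measurable_fun_itv_cc _ _ _ false true).
apply: open_continuous_measurable_fun; first exact: interval_open.
by move=> x; rewrite inE/= in_itv/=; exact: continuous_omega.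
Qed.

Lemma integral_omega (R : realType) :
  (\int[@lebesgue_measure R]_(x in `[(-1)%R, 1%R]) (omega x)%:E = pi%:E)%E.
Proof.
(* The endpoints, where 0^-1 = 0 gives [omega] the value 0, form a null set. *)
rewrite integral_itv_bndoo; last first.
  apply/measurable_EFinP; apply: (measurable_funS _ _ (@measurable_omega R)).
    exact: measurable_itv.
  exact: subset_itv_oo_cc.
apply: etrans; first apply: (@ge0_continuous_FTC2_oo _ _ (fun x => - acos x)) => //.
- by move=> x _; exact: omega_ge0.
- by move=> x; rewrite in_itv/=; exact: continuous_omega.
- by move=> x; apply: cvgN; exact: continuous_within_acos.
- move=> x; rewrite in_itv/= => xI; have H := is_derive1_acos xI.
  by apply: is_derive_eq; rewrite /omega opprK.
by rewrite /= acosN1 acos1; congr EFin; lra.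
Qed.

(* The summand 1 makes the integrand nonnegative, so that monotone convergence applies. *)
Lemma integral_cos_acos_omega1 (R : realType) (j : nat) :
  (\int[@lebesgue_measure R]_(x in `[(-1)%R, 1%R])
     ((1 + cos (j.+1%:R * acos x)) * omega x)%:E = pi%:E)%E.
Proof.
rewrite integral_itv_bndoo; last first.
  apply/measurable_EFinP; apply: (@measurable_funS _ _ _ _ (`[-1, 1]%classic : set R)).
  - exact: measurable_itv.
  - exact: subset_itv_oo_cc.
  apply: measurable_funM; last exact: measurable_omega.
  by apply: measurable_funD => //; exact: measurable_cos_acos.
apply: etrans; first apply: (@ge0_continuous_FTC2_oo _ _
  (fun x => - acos x - j.+1%:R^-1 * sin (j.+1%:R * acos x))) => //.
- move=> x _; rewrite mulr_ge0 ?omega_ge0//.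
- move=> x; rewrite in_itv/= => xI; apply: cvgM; last exact: continuous_omega.
  apply: cvgD; first exact: cvg_cst.
  apply: (@continuous_comp _ _ _ (fun x => j.+1%:R * acos x : R)); last exact: continuous_cos.
  by apply: cvgM; [exact: cvg_cst|exact: continuous_acos].
- move=> x; apply: cvgB; first by apply: cvgN; exact: continuous_within_acos.
  apply: cvgM; first exact: cvg_cst.
  by apply: continuous_within_comp_acos; exact: continuous_sin.
- move=> x; rewrite in_itv/= => xI; have H := is_derive1_acos xI.
  have H2 := derive_sin_acos j xI.
  apply: is_derive_eq; rewrite -/(omega x) /GRing.scale/=.
  by rewrite !mulrN !opprK [j.+1%:R^-1 * _]mulrA mulVf ?pnatr_eq0// mul1r mulrDl mul1r.
rewrite /= acosN1 acos1 mulr0 sin0 mulr0.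
by rewrite sin_mul_pi mulr0; congr EFin; lra.
Qed.

Lemma integrable_omega (R : realType) :
  (@lebesgue_measure R).-integrable `[-1, 1] (EFin \o @omega R).
Proof.
apply/integrableP; split; first by apply/measurable_EFinP; exact: measurable_omega.
under eq_integral do rewrite /= ger0_norm ?omega_ge0//.
by rewrite integral_omega ltry.
Qed.

Lemma bounded_integrable_omega (R : realType) (g : R -> R) (B : R) :
  measurable_fun (`[-1, 1]%classic : set R) g -> (forall x, -1 <= x <= 1 -> `|g x| <= B) ->
  (@lebesgue_measure R).-integrable `[-1, 1] (EFin \o (fun x => g x * omega x)).
Proof.
move=> mg gB.
have -> : EFin \o (fun x => g x * omega x) = ((EFin \o g) \* (EFin \o @omega R))%E.
  by apply/funext => x /=; rewrite EFinM.
apply: integrableMr => //; last exact: integrable_omega.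
exists B; split; first exact: num_real.
move=> C BC x; rewrite /= in_itv/= => /gB /le_trans; apply; exact: ltW.
Qed.

Lemma Rintegral_omega (R : realType) :
  \int[@lebesgue_measure R]_(x in `[-1, 1]) omega x = pi.
Proof. by rewrite /Rintegral integral_omega. Qed.

(** On [-1, 1] cos(j acos x) is the Chebyshev polynomial T_j, so this is its orthogonality to T_0.
    For j > 0 the integral of [omega] is subtracted from [integral_cos_acos_omega1]. *)
Lemma Rintegral_cos_acos_omega (R : realType) (j : nat) :
  \int[@lebesgue_measure R]_(x in `[-1, 1]) (cos (j%:R * acos x) * omega x) = 
    if j == 0 then pi else 0.
Proof.
case: j => [|j] /=.
  by rewrite -[RHS]Rintegral_omega; apply: eq_Rintegral => x _; rewrite mul0r cos0 mul1r.
have := integral_cos_acos_omega1 R j.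
have -> : (\int[@lebesgue_measure R]_(x in `[(-1)%R, 1%R])
    ((1 + cos (j.+1%:R * acos x)) * omega x)%:E =
  \int[@lebesgue_measure R]_(x in `[(-1)%R, 1%R])
    ((omega x)%:E + (cos (j.+1%:R * acos x) * omega x)%:E))%E.
  by apply: eq_integral => x _; rewrite mulrDl mul1r.
have I2 : (@lebesgue_measure R).-integrable `[-1, 1]
    (EFin \o (fun x => cos (j.+1%:R * acos x) * omega x)).
  apply: (@bounded_integrable_omega _ _ 1) => [|x _]; first exact: measurable_cos_acos.
  exact: cos_max.
move=> /(congr1 fine); have := RintegralD _ (integrable_omega R) I2.
rewrite /Rintegral => -> //.
by rewrite [X in X + _]Rintegral_omega /=; lra.
Qed.

Lemma measurable_cos_sum (R : realType) (c : nat -> R) (n : nat) :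
  measurable_fun (`[-1, 1]%classic : set R)
    (fun x : R => \sum_(j < n) c j * cos (j%:R * acos x)).
Proof.
elim: n => [|n IH].
  by rewrite (_ : (fun x => _) = cst 0)//; apply/funext => x; rewrite big_ord0.
rewrite (_ : (fun x => _) = (fun x : R =>
    \sum_(j < n) c j * cos (j%:R * acos x) + c n * cos (n%:R * acos x))); last first.
  by apply/funext => x; rewrite big_ord_recr.
apply: measurable_funD => //; apply: measurable_funM; first exact: measurable_cst.
exact: measurable_cos_acos.
Qed.

Lemma norm_cos_sum_le (R : realType) (c : nat -> R) (n : nat) (x : R) :
  `|\sum_(j < n) c j * cos (j%:R * acos x)| <= \sum_(j < n) `|c j|.
Proof.
apply: le_trans (ler_norm_sum _ _ _) _; apply: ler_sum => j _.
by rewrite normrM ler_piMr ?cos_max.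
Qed.

Lemma integrable_cos_sum (R : realType) (c : nat -> R) (n : nat) :
  (@lebesgue_measure R).-integrable `[-1, 1]
    (EFin \o (fun x : R => (\sum_(j < n) c j * cos (j%:R * acos x)) * omega x)).
Proof.
apply: (bounded_integrable_omega (B := \sum_(j < n) `|c j|)).
  exact: measurable_cos_sum.
by move=> x _; exact: norm_cos_sum_le.
Qed.

Lemma Rintegral_cos_sum (R : realType) (c : nat -> R) (n : nat) :
  \int[@lebesgue_measure R]_(x in `[-1, 1])
    ((\sum_(j < n.+1) c j * cos (j%:R * acos x)) * omega x) = pi * c 0%N.
Proof.
have I j : (@lebesgue_measure R).-integrable `[-1, 1]
    (EFin \o (fun x : R => cos (j%:R * acos x) * omega x)).
  apply: (bounded_integrable_omega (B := 1)) => [|x _]; last exact: cos_max.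
  exact: measurable_cos_acos.
elim: n => [|n IH].
  under eq_Rintegral do rewrite big_ord1 -mulrA.
  by rewrite RintegralZl ?Rintegral_cos_acos_omega/= 1?mulrC//; exact: I.
under eq_Rintegral do rewrite big_ord_recr/= mulrDl.
rewrite RintegralD//; [|exact: integrable_cos_sum|].
  rewrite IH; under eq_Rintegral do rewrite -mulrA.
  by rewrite RintegralZl ?Rintegral_cos_acos_omega/= ?mulr0 ?addr0//; exact: I.
have := integrable_cos_sum (fun k => if k == n.+1 then c k else 0) n.+2.
congr (_.-integrable _ _); apply/funext => x /=; congr (_ * _)%:E.
rewrite big_ord_recr/= eqxx big1 ?add0r// => j _.
by rewrite (ltn_eqF (ltn_ord j)) mul0r.
Qed.

(** A uniform limit of cosine sums is bounded and measurable, hence integrable against [omega]. Only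
    the constant terms contribute to the integrals of the sums, and these terms approach [v]. *)
Lemma integral_cos_sum_approx (R : realType) (g : R -> R) (v : R) :
  (forall e : R, 0 < e -> exists (c : nat -> R) (n : nat),
     (forall x : R, -1 <= x <= 1 ->
        `|g x - \sum_(j < n.+1) c j * cos (j%:R * acos x)| <= e) /\
     `|c 0%N - v| <= e) ->
  (@lebesgue_measure R).-integrable `[-1, 1] (EFin \o (fun x => g x * omega x)) /\
  \int[@lebesgue_measure R]_(x in `[-1, 1]) (g x * omega x) = pi * v.
Proof.
move=> approx.
(* A sequence of approximations with tolerance 1/(n+1) exhibits [g] as a pointwise limit of
   measurable functions. *)
have [P PP] : exists P : nat -> (nat -> R) * nat, forall n,
    forall x : R, -1 <= x <= 1 ->
    `|g x - \sum_(j < (P n).2.+1) (P n).1 j * cos (j%:R * acos x)| <= n.+1%:R^-1.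
  suff /choice[P PP] : forall n, exists cm : (nat -> R) * nat, forall x : R, -1 <= x <= 1 ->
      `|g x - \sum_(j < cm.2.+1) cm.1 j * cos (j%:R * acos x)| <= n.+1%:R^-1.
    by exists P.
  move=> n; have e0 : 0 < n.+1%:R^-1 :> R by rewrite invr_gt0.
  by have [c [m [gc _]]] := approx _ e0; exists (c, m).
have mg : measurable_fun (`[-1, 1]%classic : set R) g.
  apply: (measurable_fun_cvg (h := fun n x =>
    \sum_(j < (P n).2.+1) (P n).1 j * cos (j%:R * acos x))).
    by move=> n; exact: measurable_cos_sum.
  move=> x; rewrite /= in_itv/= => xI; apply/cvgrPdist_le => e e0.
  have /cvgr0_norm_le /(_ _ e0) := @cvg_harmonic R; apply: filterS => n /=.
  by rewrite /harmonic/= ger0_norm ?invr_ge0//; apply: le_trans; exact: PP.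
have [B gB] : exists B : R, forall x : R, -1 <= x <= 1 -> `|g x| <= B.
  have [c [n [gc _]]] := approx _ ltr01.
  exists (1 + \sum_(j < n.+1) `|c j|) => x xI.
  rewrite -(subrK (\sum_(j < n.+1) c j * cos (j%:R * acos x)) (g x)).
  by apply: le_trans (ler_normD _ _) _; rewrite lerD ?gc// norm_cos_sum_le.
have Ig := bounded_integrable_omega mg gB; split=> //.
apply/eqP; rewrite -subr_eq0 -normr_le0; apply/ler_addgt0Pr => e e0; rewrite add0r.
have pi0 := pi_gt0 R.
(* The integral of [omega] is pi, so with this tolerance the approximation of [g] and that of [v]
   each cost at most e/2. *)
have [c [n [pg pv]]] := approx (e / pi / 2) (divr_gt0 (divr_gt0 e0 pi0) (ltr0n _ 2)).
pose h x := \sum_(j < n.+1) c j * cos (j%:R * acos x).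
have Ip : (@lebesgue_measure R).-integrable `[-1, 1] (EFin \o (fun x => h x * omega x)).
  exact: integrable_cos_sum.
rewrite (_ : _ - _ =
   (\int[@lebesgue_measure R]_(x in `[-1, 1]) (g x * omega x - h x * omega x)) +
   pi * (c 0%N - v)); last first.
  by rewrite RintegralB// Rintegral_cos_sum; ring.
apply: le_trans (ler_normD _ _) _.
have pine : pi != 0 :> R by rewrite gt_eqF.
have -> : e = e / pi / 2 * pi + pi * (e / pi / 2).
  by rewrite [pi * _]mulrC -mulrDl -splitr divfK.
apply: lerD; last by rewrite normrM gtr0_norm// ler_pM2l.
have Id : (@lebesgue_measure R).-integrable `[-1, 1]
    (EFin \o (fun x => g x * omega x - h x * omega x)).
  have := integrableB _ Ig Ip.
  by apply; exact: measurable_itv.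
apply: le_trans (le_normr_Rintegral _ Id) _ => //.
rewrite -[X in _ * X]Rintegral_omega -RintegralZl ?integrable_omega//.
apply: le_Rintegral => //.
- exact: integrable_norm.
- apply: (@bounded_integrable_omega _ (cst (e / pi / 2)) `|e / pi / 2|) => //.
move=> x; rewrite /= in_itv/= => xI.
by rewrite -mulrBl normrM (ger0_norm (omega_ge0 x)) ler_wpM2r ?omega_ge0 ?pg.
Qed.

(** * Circle means by polynomial approximation *)

Section DiscApproximation.
Variable R : realType.
Notation C := R[i].
Implicit Types (g h : C -> C) (a c z : C) (p : {poly C}).

(** Membership in the disc algebra, as a uniform limit of polynomials on the closed disc; it reduces
    the mean value property to monomials. In the order of [C], 0 < e forces [e] to be real. *)
Definition disc_approx g := forall e : C, 0 < e ->
  exists p : {poly C}, forall z, `|z| <= 1 -> `|g z - p.[z]| <= e.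

Lemma exp_norm_small c (e : C) : `|c| < 1 -> 0 < e -> exists n, `|c| ^+ n <= e.
Proof.
move=> c1 e0.
have eE : e = (complex.Re e)%:C by rewrite RRe_real// ger0_real// ltW.
have cE : `|c| = (complex.Re `|c|)%:C by rewrite RRe_real// normr_real.
have r0 : 0 < complex.Re e by move: e0; rewrite ltcE => /andP[].
have rc0 : 0 <= complex.Re `|c| by rewrite -ler0c -cE.
have rc1 : `|complex.Re `|c| | < 1 by rewrite ger0_norm// -ltcR -cE.
have /cvgr0_norm_le /(_ _ r0) [n _ /(_ n (leqnn _))] := cvg_expr rc1.
rewrite /= ger0_norm ?exprn_ge0// => H; exists n.
by move: H; rewrite -lecR rmorphXn/= -cE -eE.
Qed.

Lemma norm_horner_disc p z : `|z| <= 1 -> `|p.[z]| <= \sum_(i < size p) `|p`_i|.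
Proof.
move=> z1; rewrite horner_coef; apply: le_trans (ler_norm_sum _ _ _) _.
apply: ler_sum => i _; rewrite normrM normrX ler_piMr// exprn_ile1//.
Qed.

Lemma disc_approx_poly p : disc_approx (horner p).
Proof. by move=> e e0; exists p => z _; rewrite subrr normr0 ltW. Qed.

Lemma disc_approx_bounded g : disc_approx g ->
  exists2 B : C, 0 < B & forall z, `|z| <= 1 -> `|g z| <= B.
Proof.
move=> /(_ 1 ltr01) [p pg]; exists (1 + \sum_(i < size p) `|p`_i|).
  by rewrite ltr_pwDl// sumr_ge0.
move=> z z1; rewrite -(subrK p.[z] (g z)); apply: le_trans (ler_normD _ _) _.
by rewrite lerD ?pg ?norm_horner_disc.
Qed.

Lemma disc_approx_add g h : disc_approx g -> disc_approx h ->
  disc_approx (fun z => g z + h z).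
Proof.
move=> ag ah e e0; have e2 : 0 < e / 2 by rewrite divr_gt0.
have [[p pg] [q qh]] := (ag _ e2, ah _ e2); exists (p + q) => z z1.
rewrite hornerD opprD addrACA [leRHS]splitr.
by apply: le_trans (ler_normD _ _) _; rewrite lerD ?pg ?qh.
Qed.

Lemma disc_approx_mul g h : disc_approx g -> disc_approx h ->
  disc_approx (fun z => g z * h z).
Proof.
move=> ag ah e e0; have e2 : 0 < e / 2 by rewrite divr_gt0.
have [B B0 gB] := disc_approx_bounded ag.
(* [q] is fixed first, since the tolerance for [p] depends on a bound for [q]. *)
have [q qh] := ah _ (divr_gt0 e2 B0).
have [D D0 qD] := disc_approx_bounded (disc_approx_poly q).
have [p pg] := ag _ (divr_gt0 e2 D0).
exists (p * q) => z z1; rewrite hornerM.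
have -> : g z * h z - p.[z] * q.[z] = g z * (h z - q.[z]) + (g z - p.[z]) * q.[z] by ring.
apply: le_trans (ler_normD _ _) _; rewrite !normrM [leRHS]splitr lerD//.
  apply: le_trans (ler_pM _ _ (gB z z1) (qh z z1)) _ => //.
  by rewrite mulrC divfK ?gt_eqF.
apply: le_trans (ler_pM _ _ (pg z z1) (qD z z1)) _ => //.
by rewrite divfK ?gt_eqF.
Qed.

Lemma disc_approx_geometric c : `|c| < 1 -> disc_approx (fun z => (1 - z * c)^-1).
Proof.
move=> c1 e e0; have c0 : 0 < 1 - `|c| by rewrite subr_gt0.
(* The remainder after n terms of the geometric series is at most |c|^n/(1 - |c|) on the disc. *)
have [n cn] := exp_norm_small c1 (mulr_gt0 e0 c0).
exists (\sum_(i < n) (c *: 'X) ^+ i) => z z1.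
have zc1 : `|z * c| <= `|c| by rewrite normrM ler_piMl.
have lbd : 1 - `|c| <= `|1 - z * c|.
  apply: le_trans (lerB_normD _ _); rewrite normr1 normrN lerD2l lerN2//.
have d0 : 0 < `|1 - z * c| by exact: lt_le_trans c0 lbd.
have dn0 : 1 - z * c != 0 by rewrite -normr_gt0.
have -> : (\sum_(i < n) (c *: 'X) ^+ i).[z] = (1 - (z * c) ^+ n) / (1 - z * c).
  apply: (mulIf dn0); rewrite divfK// horner_sum mulrC -opprB mulNr.
  rewrite -[RHS]opprB subrX1; congr (- (_ * _)).
  by apply: eq_bigr => i _; rewrite horner_exp !hornerE mulrC.
have -> : (1 - z * c)^-1 - (1 - (z * c) ^+ n) / (1 - z * c) = (z * c) ^+ n / (1 - z * c).
  by rewrite -{1}[_^-1]mul1r -mulrBl opprB addrC subrK.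
rewrite normrM normfV normrX ler_pdivrMr//.
apply: (@le_trans _ _ (`|c| ^+ n)); first by rewrite lerXn2r ?nnegrE.
by apply: le_trans cn _; rewrite ler_pM2l.
Qed.

Lemma disc_approx_blaschke_den (s : seq C) p : {in s, forall a, `|a| < 1} ->
  disc_approx (fun z => p.[z] / (blaschke_den s).[z]).
Proof.
move=> s1; apply: disc_approx_mul; first exact: disc_approx_poly.
rewrite (_ : (fun z => _) = fun z => (\prod_(a <- s) (1 - z * a^* ))^-1); last first.
  by apply/funext => z; rewrite horner_blaschke_den.
elim: s s1 => [|a s IH] s1.
  rewrite (_ : (fun z => _) = horner 1); first exact: disc_approx_poly.
  by apply/funext => z; rewrite big_nil invr1 hornerE.
rewrite (_ : (fun z => _) = fun z =>
    (1 - z * a^*)^-1 * (\prod_(b <- s) (1 - z * b^*))^-1); last first.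
  by apply/funext => z; rewrite big_cons invfM.
apply: disc_approx_mul.
  by apply: disc_approx_geometric; rewrite norm_conjC s1// mem_head.
by apply: IH => b bs; rewrite s1// inE bs orbT.
Qed.

End DiscApproximation.

Section Expi.
Variable R : realType.
Implicit Types a b : R.

Lemma expiD a b : expi (a + b) = expi a * expi b.
Proof. by rewrite /expi cosD sinD; apply/eqP; rewrite eq_complex /= eqxx addrC eqxx. Qed.

Lemma expi0 : expi (0 : R) = 1.
Proof. by rewrite /expi cos0 sin0. Qed.

Lemma expiX a n : expi a ^+ n = expi (n%:R * a).
Proof.
elim: n => [|n IH]; first by rewrite mul0r expi0.
by rewrite exprS IH -expiD -nat1r mulrDl mul1r.
Qed.

Lemma expiN a : expi (- a) = (expi a)^-1.
Proof.
have H : expi (- a) * expi a = 1 by rewrite -expiD addNr expi0.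
have e0 : expi a != 0 by apply: contra_eqN H => /eqP ->; rewrite mulr0 eq_sym oner_eq0.
by apply: (mulIf e0); rewrite H mulVf.
Qed.

Lemma norm_expi a : `|expi a| = 1.
Proof. by rewrite normc_def /= cos2Dsin2 sqrtr1. Qed.

Lemma expi_addV a : expi a + (expi a)^-1 = (2 * cos a)%:C.
Proof.
rewrite -expiN /expi cosN sinN; apply/eqP.
by rewrite eq_complex /= subrr eqxx andbT mulr2n mulrDl !mul1r.
Qed.

End Expi.

(** * The mean value property, transported to the segment *)

Section CircleMean.
Variable R : realType.
Notation C := R[i].

Lemma Re_norm_le (w : C) (e : R) : `|w| <= e%:C -> `|complex.Re w| <= e.
Proof. by move=> we; rewrite -lecR (le_trans (normc_ge_Re _)). Qed.

Lemma Im_norm_le (w : C) (e : R) : `|w| <= e%:C -> `|complex.Im w| <= e.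
Proof.
move=> we; have -> : complex.Im w = complex.Re (w * - 'i%C).
  by rewrite mulrN raddfN /= ReiNIm opprK.
apply: Re_norm_le; rewrite normrM normrN.
by rewrite [`|'i%C|]normc_def /= expr0n expr1n add0r sqrtr1 mulr1.
Qed.

(** With z = e^(i acos x), replacing K by a polynomial turns (K(z) + K(1/z))/2 into a cosine sum,
    because z^j + z^-j = 2 cos(j acos x). *)
Lemma disc_approx_cos_sum (K : C -> C) (g : R -> C) : disc_approx K ->
  (forall z, `|z| = 1 -> g (complex.Re z) * 2 = K z + K z^-1) ->
  forall e : R, 0 < e -> exists (c : nat -> C) (n : nat),
    (forall x : R, -1 <= x <= 1 ->
      `|g x - \sum_(j < n.+1) c j * (cos (j%:R * acos x))%:C| <= e%:C) /\
    `|c 0%N - K 0| <= e%:C.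
Proof.
move=> aK gK e e0; have e0' : 0 < e%:C by rewrite ltcE /= eqxx.
(* The sum has one term more than [p] has coefficients; the extra one is 0 by default, and the zero
   polynomial is covered too. *)
have [p pK] := aK _ e0'; exists (fun j => p`_j), (size p); split; last first.
  by rewrite -horner_coef0 -normrN opprB; apply: pK; rewrite normr0.
move=> x xI; pose z := expi (acos x).
have z1 : `|z| = 1 by exact: norm_expi.
have Rez : complex.Re z = x by rewrite /= acosK// in_itv.
have pE w : p.[w] = \sum_(j < (size p).+1) p`_j * w ^+ j by exact: horner_coef_wide.
have two0 : (2 : C) != 0 by rewrite pnatr_eq0.
have -> : g x - \sum_(j < (size p).+1) p`_j * (cos (j%:R * acos x))%:C =
    ((K z - p.[z]) + (K z^-1 - p.[z^-1])) / 2.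
  apply: (mulIf two0); rewrite divfK// mulrBl -{1}Rez gK// addrACA -opprD; congr (_ - _).
  rewrite !pE -big_split/= mulr_suml; apply: eq_bigr => j _.
  rewrite -mulrDr -mulrA; congr (_ * _); rewrite exprVn expiX expi_addV.
  by rewrite rmorphM/= mulrC rmorph_nat.
rewrite normrM normfV [`|2|]ger0_norm// ler_pdivrMr// mulr_natr mulr2n.
by apply: le_trans (ler_normD _ _) _; rewrite lerD// pK ?normfV ?z1 ?invr1.
Qed.

Lemma cintegral_disc_approx (K : C -> C) (g : R -> C) : disc_approx K ->
  (forall z, `|z| = 1 -> g (complex.Re z) * 2 = K z + K z^-1) ->
  cintegrable `[-1, 1] (fun x => g x * (omega x)%:C) /\
  cintegral `[-1, 1] (fun x => g x * (omega x)%:C) = pi%:C * K 0.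
Proof.
move=> aK gK; have apx := disc_approx_cos_sum aK gK.
have ReM (w : C) (t : R) : complex.Re (w * t%:C) = complex.Re w * t.
  by case: w => a b /=; rewrite mulr0 subr0.
have ImM (w : C) (t : R) : complex.Im (w * t%:C) = complex.Im w * t.
  by case: w => a b /=; rewrite mulr0 add0r.
have [|IRe ERe] := @integral_cos_sum_approx R (fun x => complex.Re (g x)) (complex.Re (K 0)).
  move=> e e0; have [c [n [gc c0]]] := apx e e0.
  exists (fun j => complex.Re (c j)), n; split=> [x xI|]; last first.
    by rewrite -raddfB; exact: Re_norm_le.
  under eq_bigr do rewrite -ReM.
  by rewrite -raddf_sum -raddfB; exact/Re_norm_le/gc.
have [|IIm EIm] := @integral_cos_sum_approx R (fun x => complex.Im (g x)) (complex.Im (K 0)).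
  move=> e e0; have [c [n [gc c0]]] := apx e e0.
  exists (fun j => complex.Im (c j)), n; split=> [x xI|]; last first.
    by rewrite -raddfB; exact: Im_norm_le.
  under eq_bigr do rewrite -ImM.
  by rewrite -raddf_sum -raddfB; exact/Im_norm_le/gc.
split; first split.
- rewrite (_ : (fun x => _) = EFin \o (fun x => complex.Re (g x) * omega x))//.
  by apply/funext => x; rewrite ReM.
- rewrite (_ : (fun x => _) = EFin \o (fun x => complex.Im (g x) * omega x))//.
  by apply/funext => x; rewrite ImM.
have -> : pi%:C * K 0 = (pi * complex.Re (K 0)) +i* (pi * complex.Im (K 0)).
  by case: (K 0) => a b; apply/eqP; rewrite eq_complex /= !mul0r subr0 addr0 !eqxx.
rewrite /cintegral -ERe -EIm.
by congr (_ +i* _); apply: eq_Rintegral => x _; rewrite ?ReM ?ImM.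
Qed.

End CircleMean.

Section RationalQuadrature.
Variable R : realType.
Notation C := R[i].

(** The integral divided by pi and the weighted sum are both v(0), for p/(S D) = u/S + v/D. *)
Lemma integral_blaschke_quadrature (s : seq C) (e : C) (p : {poly C}) (g : R -> C) (r : seq C) :
  {in s, forall a, `|a| < 1} -> `|e| = 1 -> (size p <= (size s).*2.+1)%N ->
  (forall z, `|z| = 1 ->
     g (complex.Re z) = p.[z] / ((blaschke_num s).[z] * (blaschke_den s).[z])) ->
  uniq r -> node_poly s e = \prod_(x <- r) ('X - x%:P) ->
  cintegrable `[-1, 1] (fun x => g x * (omega x)%:C) /\
  cintegral `[-1, 1] (fun x => g x * (omega x)%:C) =
    pi%:C * \sum_(x <- r) g (complex.Re x) / (poisson_sum s x + 1).
Proof.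
move=> s1 e1 sp gE ur rE.
have [u [v [su sv pE]]] := blaschke_partial_fraction s1 sp.
have gUV z : `|z| = 1 ->
    g (complex.Re z) = u.[z] / (blaschke_num s).[z] + v.[z] / (blaschke_den s).[z].
  move=> z1; rewrite gE// pE hornerD !hornerM.
  have N0 : (blaschke_num s).[z] != 0 by apply: blaschke_num_neq0 => //; rewrite z1.
  have D0 : (blaschke_den s).[z] != 0 by apply: blaschke_den_neq0 => //; rewrite z1.
  by field; rewrite N0 D0.
(* In the variable 1/z the term u/S has the denominator belonging to the conjugated list, with no
   zeros in the closed disc. *)
pose s' := [seq a^* | a <- s].
have s'1 : {in s', forall a, `|a| < 1}.
  by move=> _ /mapP [a as_ ->]; rewrite norm_conjC s1.
pose h : {poly C} := rev_poly (size s) u.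
have uE z : z != 0 -> u.[z] / (blaschke_num s).[z] = h.[z^-1] / (blaschke_den s').[z^-1].
  move=> z0.
  have zN : z ^+ size s = \prod_(a <- s) z.
    by rewrite big_const_seq count_predT iter_mulr_1.
  have -> : (blaschke_num s).[z] = z ^+ size s * (blaschke_den s').[z^-1].
    rewrite horner_blaschke_num horner_blaschke_den big_map zN -big_split/=.
    by apply: eq_bigr => a _; rewrite conjCK mulrBr mulr1 mulVKf.
  have -> : u.[z] = z ^+ size s * h.[z^-1].
    by rewrite horner_rev_poly ?invr_eq0 ?leqW// invrK exprVn mulVKf ?expf_neq0.
  by rewrite -mulf_div divff ?mul1r// expf_neq0.
(* As z and 1/z have the same real part on the circle, adding the decompositions of [g] at both
   gives K(z) + K(1/z). *)
pose K z := v.[z] / (blaschke_den s).[z] + h.[z] / (blaschke_den s').[z].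
have aK : disc_approx K.
  by apply: disc_approx_add; exact: disc_approx_blaschke_den.
have [z|Ig Eg] := cintegral_disc_approx (g := g) aK.
  move=> z1; have z0 : z != 0 by rewrite -normr_gt0 z1.
  have zV1 : `|z^-1| = 1 by rewrite normfV z1 invr1.
  have ReV : complex.Re z^-1 = complex.Re z.
    by rewrite -[z^-1]mul1r -(expr1n _ 2) -z1 normCK mulrAC divff// mul1r; case: (z).
  rewrite mulr_natr mulr2n {2}[complex.Re z](esym ReV) !gUV// !uE ?invr_eq0// invrK.
  by rewrite /K addrACA addrC [X in _ = X]addrC; ring.
split=> //; rewrite Eg; congr (_ * _).
(* h(0) is the coefficient of [u] of index [size s], which is 0 because deg u < deg S. *)
have -> : K 0 = v.[0].
  by rewrite /K !blaschke_den0 !divr1 rev_poly_at0 nth_default ?addr0.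
rewrite -(blaschke_quadrature s1 e1 ur rE su sv); apply: eq_big_seq => x xr.
by rewrite gUV// (norm_root_node_poly s1 e1)// rE root_prod_XsubC.
Qed.

End RationalQuadrature.

(** * Poles and degree of a rational function *)

Section Poles.
Variable R : realType.
Notation C := R[i].
Implicit Types (f : C -> C) (p q : {poly C}) (a z : C).

Lemma pole_mult_of_frac f p q a k : q.[a] != 0 -> ((0 < k)%N -> p.[a] != 0) ->
  (forall z, z != a -> q.[z] != 0 -> f z = p.[z] / ((z - a) ^+ k * q.[z])) ->
  pole_mult f a k.
Proof.
move=> qa pa fE.
have q0 : q != 0 by apply: contraNneq qa => ->; rewrite horner0.
have [s sq] := nonroot_off q0.
exists p, q, (a :: s); split=> // z; rewrite inE negb_or => /andP[za /sq qz].
exact: fE.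
Qed.

(** If k < l, cross-multiplying gives p (z - a)^(l-k) q' = p' q, whose left side vanishes at [a] and
    whose right side does not. *)
Lemma pole_mult_unique f a k l : pole_mult f a k -> pole_mult f a l -> k = l.
Proof.
wlog kl : k l / (k < l)%N.
  by move=> H; case: (ltngtP k l) => // lt mk ml; [exact: (H k l)|apply/esym/(H l k)].
move=> [p [q [s [qa _ fk]]]] [p' [q' [s' [qa' pa' fl]]]]; exfalso.
have q0 : q != 0 by apply: contraNneq qa => ->; rewrite horner0.
have q0' : q' != 0 by apply: contraNneq qa' => ->; rewrite horner0.
have d0 : ('X - a%:P) * (q * q') != 0 by rewrite !mulf_neq0 ?polyXsubC_eq0.
have [r dr] := nonroot_off d0.
have E : p * (('X - a%:P) ^+ (l - k) * q') = p' * q.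
  apply: (@poly_eq_off _ _ _ (r ++ (s ++ s'))) => z.
  rewrite !mem_cat !negb_or => /andP[/dr + /andP[/fk E1 /fl E2]].
  rewrite !hornerM hornerXsubC !mulf_eq0 !negb_or => /and3P[za qz qz'].
  move: E1; rewrite E2 => /eqP; rewrite eqr_div ?mulf_neq0 ?expf_neq0// => /eqP H.
  apply: (mulfI (expf_neq0 k za)); rewrite horner_exp hornerXsubC.
  have zl : (z - a) ^+ l = (z - a) ^+ (l - k) * (z - a) ^+ k by rewrite -exprD subnK// ltnW.
  by move: H; rewrite zl => H; rewrite [RHS]mulrCA -[LHS]mulrCA; rewrite H; ring.
have := congr1 (horner^~ a) E; rewrite !hornerM horner_exp hornerXsubC subrr.
rewrite expr0n subn_eq0 leqNgt kl mul0r mulr0 => /esym/eqP; apply/negP.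
by rewrite mulf_neq0// pa'// (leq_trans _ kl).
Qed.

Lemma pole_orderE f a k : pole_mult f a k -> pole_order f a = k.
Proof.
move=> mk; rewrite /pole_order; case: xgetP => [l _ /= ml|/(_ k)//].
exact: pole_mult_unique ml mk.
Qed.

(** A positive value cannot be the default 0 of [xget]. *)
Lemma pole_orderP f a : (0 < pole_order f a)%N -> pole_mult f a (pole_order f a).
Proof. by rewrite /pole_order; case: xgetP. Qed.

Section Ratfun.
Variables (f : C -> C) (p q : {poly C}).
Hypotheses (cpq : coprimep p q) (q0 : q != 0).
Hypothesis fE : forall z, q.[z] != 0 -> f z = p.[z] / q.[z].

Lemma pole_order_frac (r : seq C) a : q = lead_coef q *: \prod_(z <- r) ('X - z%:P) ->
  pole_order f a = count_mem a r.
Proof.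
move=> qE; apply: pole_orderE.
pose q' := lead_coef q *: \prod_(z <- r | z != a) ('X - z%:P).
have qE' : q = ('X - a%:P) ^+ count_mem a r * q'.
  rewrite {1}qE (bigID (pred1 a))/= -scalerAr; congr (_ *: (_ * _)).
  rewrite (eq_bigr (fun _ => 'X - a%:P)); last by move=> z /eqP ->.
  by rewrite big_const_seq iter_mulr_1.
have qa : q'.[a] != 0.
  rewrite hornerZ mulf_neq0 ?lead_coef_eq0// horner_prod prodf_seq_neq0.
  by apply/allP => z _ /=; apply/implyP => za; rewrite hornerXsubC subr_eq0 eq_sym.
apply: (pole_mult_of_frac (p := p) (q := q')) => // [k0|z za qz].
  rewrite -rootE; apply: contraTN cpq => pa.
  apply/negP => /coprimep_root /(_ pa) /eqP; apply.
  by rewrite qE' hornerM horner_exp hornerXsubC subrr expr0n gtn_eqF// mul0r.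
have qz' : q.[z] = (z - a) ^+ count_mem a r * q'.[z].
  by rewrite {1}qE' hornerM horner_exp hornerXsubC.
by rewrite fE qz'// mulf_neq0// expf_neq0// subr_eq0.
Qed.

(** The reciprocals of [p] and [q] have the leading coefficients as values at 0, and f(1/z) is their
    quotient times the power of z left over from the two degrees. *)
Lemma pole_order_infty_frac : (size q < size p)%N ->
  pole_order_infty f = (size p - size q)%N.
Proof.
move=> spq; apply: pole_orderE.
have p0 : p != 0 by rewrite -size_poly_gt0; exact: leq_trans spq.
have sq0 : (0 < size q)%N by rewrite size_poly_gt0.
apply: (pole_mult_of_frac (p := rev_poly (size p).-1 p) (q := rev_poly (size q).-1 q)).
- by rewrite rev_poly_at0 lead_coef_eq0.
- by rewrite rev_poly_at0 lead_coef_eq0.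
move=> z z0; rewrite !horner_rev_poly ?leqSpred//.
rewrite mulf_eq0 negb_or => /andP[_ qz].
rewrite fE// subr0 mulrA -exprD -!subn1.
have -> : (size p - size q + (size q - 1) = size p - 1)%N by lia.
by rewrite -mulf_div divff ?mul1r// expf_neq0.
Qed.

(** The finite poles contribute deg q, and infinity adds deg p - deg q when this is positive. *)
Lemma ratdegree_frac_ge : (maxn (size p).-1 (size q).-1 <= ratdegree f)%N.
Proof.
have [r qE] := closed_field_poly_normal q.
have sr : (size q).-1 = size r by rewrite qE size_scale ?lead_coef_eq0// size_prod_XsubC.
have -> : ratdegree f = (size r + pole_order_infty f)%N.
  rewrite /ratdegree; congr (_ + _)%N.
  have -> : pole_order f = fun a => count_mem a r.
    by apply/funext => a; exact: pole_order_frac.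
  rewrite (fsbigE (undup r))//; last 2 first.
  - exact: undup_uniq.
  - by move=> a _; rewrite mem_undup => /count_memPn.
  under eq_bigl do rewrite in_setT.
  rewrite -[in RHS](perm_size (perm_count_undup r)) size_flatten sumnE !big_map.
  by apply: eq_bigr => a _; rewrite size_nseq.
rewrite -sr geq_max leq_addr andbT; have [pq|qp] := leqP (size p) (size q).
  by rewrite (leq_trans _ (leq_addr _ _))// -!subn1 leq_sub2r.
by rewrite pole_order_infty_frac//; move: qp; lia.
Qed.

End Ratfun.
End Poles.

(** * Factorization of the denominator *)

Section Zseq.
Variables (R : realType) (nu : nat).
Notation C := R[i].
Implicit Types (w : C) (m : nat).

Definition zseq (z_ : 'I_nu -> C) (n_ : 'I_nu -> nat) : seq C :=
  flatten [seq nseq (n_ k) (z_ k) | k <- enum 'I_nu].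

Lemma prod_zseq (T : comNzRingType) (z_ : 'I_nu -> C) (n_ : 'I_nu -> nat) (F : C -> T) :
  \prod_(a <- zseq z_ n_) F a = \prod_(k < nu) F (z_ k) ^+ n_ k.
Proof.
rewrite big_flatten big_map big_enum /=; apply: eq_bigr => k _.
by rewrite big_nseq iter_mulr_1.
Qed.

Lemma sum_zseq (V : nmodType) (z_ : 'I_nu -> C) (n_ : 'I_nu -> nat) (F : C -> V) :
  \sum_(a <- zseq z_ n_) F a = \sum_(k < nu) F (z_ k) *+ n_ k.
Proof.
rewrite big_flatten big_map big_enum /=; apply: eq_bigr => k _.
by rewrite big_nseq iter_addr_0.
Qed.

Lemma size_zseq (z_ : 'I_nu -> C) (n_ : 'I_nu -> nat) :
  size (zseq z_ n_) = (\sum_(k < nu) n_ k)%N.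
Proof.
rewrite -sum1_size big_flatten big_map big_enum /=; apply: eq_bigr => k _.
by rewrite sum1_size size_nseq.
Qed.

Lemma mem_zseq (z_ : 'I_nu -> C) (n_ : 'I_nu -> nat) a :
  a \in zseq z_ n_ -> exists k, a = z_ k.
Proof.
by move=> /flatten_mapP [k _]; rewrite mem_nseq => /andP[_ /eqP]; exists k.
Qed.

Lemma blaschke_num_zseq (z_ : 'I_nu -> C) (n_ : 'I_nu -> nat) :
  blaschke_num (zseq z_ n_) = \prod_(k < nu) ('X - (z_ k)%:P) ^+ n_ k.
Proof. exact: prod_zseq. Qed.

(** Scaling the multiplicities by m realizes B_0^m as the Blaschke product of a longer list, so the
    norm formula becomes an instance of the same quadrature. *)
Lemma blaschke_num_zseq_exp (z_ : 'I_nu -> C) (n_ : 'I_nu -> nat) m :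
  blaschke_num (zseq z_ (fun k => n_ k * m)%N) = blaschke_num (zseq z_ n_) ^+ m.
Proof.
by rewrite /blaschke_num !prod_zseq -prodrXl; apply: eq_bigr => k _; rewrite exprM.
Qed.

Lemma blaschke_den_zseq_exp (z_ : 'I_nu -> C) (n_ : 'I_nu -> nat) m :
  blaschke_den (zseq z_ (fun k => n_ k * m)%N) = blaschke_den (zseq z_ n_) ^+ m.
Proof.
by rewrite /blaschke_den !prod_zseq -prodrXl; apply: eq_bigr => k _; rewrite exprM.
Qed.

Lemma blaschke0_exp (z_ : 'I_nu -> C) (n_ : 'I_nu -> nat) m w :
  blaschke0 z_ n_ w ^+ m = blaschke0 z_ (fun k => n_ k * m)%N w.
Proof. by rewrite /blaschke0 -prodrXl; apply: eq_bigr => k _; rewrite exprM. Qed.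

Lemma mu0_mul (z_ : 'I_nu -> C) (n_ : 'I_nu -> nat) m w :
  m%:R * mu0 z_ n_ w = mu0 z_ (fun k => n_ k * m)%N w.
Proof.
rewrite /mu0 mulr_sumr; apply: eq_bigr => k _.
by rewrite natrM !mulrA [m%:R * _]mulrC.
Qed.

Lemma blaschke0_frac (z_ : 'I_nu -> C) (n_ : 'I_nu -> nat) w :
  blaschke0 z_ n_ w = (blaschke_num (zseq z_ n_)).[w] / (blaschke_den (zseq z_ n_)).[w].
Proof.
rewrite horner_blaschke_num horner_blaschke_den !prod_zseq -prodf_div.
by apply: eq_bigr => k _; rewrite expr_div_n.
Qed.

Lemma mu0_poisson_sum (z_ : 'I_nu -> C) (n_ : 'I_nu -> nat) w :
  (mu0 z_ n_ w)%:C = poisson_sum (zseq z_ n_) w.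
Proof.
rewrite /mu0 /poisson_sum sum_zseq rmorph_sum; apply: eq_bigr => k _ /=.
rewrite rmorphM fmorphV rmorphXn rmorphM rmorphB rmorphXn rmorph_nat rmorph1 /=.
by rewrite -mulrA mulr_natl.
Qed.

Lemma roots_of_eq_zseq (z_ : 'I_nu -> C) (n_ : 'I_nu -> nat) (phi : R) :
  {in zseq z_ n_, forall a, `|a| < 1} ->
  exists r : seq C, [/\ roots_of_eq (blaschke0 z_ n_) phi r,
    size r = (size (zseq z_ n_)).+1, {in r, forall w, `|w| = 1} &
    node_poly (zseq z_ n_) (expi phi) = \prod_(x <- r) ('X - x%:P)].
Proof.
move=> s1; have e1 := norm_expi phi.
have [r [ur sr rE]] := node_poly_roots s1 e1; exists r; split=> //; last first.
  by move=> w wr; apply: (norm_root_node_poly s1 e1); rewrite rE root_prod_XsubC.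
split=> // w; rewrite -root_prod_XsubC -rE blaschke0_frac.
split=> [rw|E].
  have D0 : (blaschke_den (zseq z_ n_)).[w] != 0.
    by apply: blaschke_den_neq0 => //; rewrite (norm_root_node_poly s1 e1 rw).
  by move: rw; rewrite root_node_poly mulrA => /eqP ->; rewrite mulfK.
have e0 : expi phi != 0 by rewrite -normr_gt0 e1.
have D0 : (blaschke_den (zseq z_ n_)).[w] != 0.
  (* By the convention 0^-1 = 0, a zero of D would give the value 0 instead of e^(i phi), so
     clearing the denominator loses no solution. *)
  by apply: contraNneq e0 => D0; rewrite -E D0 invr0 !mulr0.
by rewrite root_node_poly -E mulrA divfK.
Qed.

End Zseq.

Section MulConj.
Variables (R : realType) (n : nat).
Notation C := R[i].

Lemma size_mul_conj_le (u v : {poly C}) : (size u <= n.+1)%N -> (size v <= n.+1)%N ->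
  (size (u * conj_poly v)%R <= (2 * n).+1)%N.
Proof.
move=> su sv; apply: leq_trans (size_polyMleq _ _) _; rewrite size_conj_poly.
by have := leq_add su sv; move: (size u) (size v) => k l; lia.
Qed.

Lemma conj_joukowski (z : C) : joukowski (z^*)^-1 = (joukowski z)^*.
Proof.
by rewrite /joukowski rmorphM rmorphD !fmorphV/= rmorph_nat invrK addrC.
Qed.

Lemma horner_jpoly_mul_conj (u v : {poly C}) z :
  (size u <= n.+1)%N -> (size v <= n.+1)%N -> z != 0 ->
  (jpoly (2 * n) (u * conj_poly v)).[z] =
  z ^+ (2 * n) * (u.[joukowski z] * (v.[(joukowski z)^*])^*).
Proof.
move=> su sv z0; rewrite horner_jpoly ?size_mul_conj_le// hornerM horner_conj_poly.
by rewrite -/(joukowski z).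
Qed.

End MulConj.

(** * Poles of [calR] as zeros of the polynomial T *)

Section CalR.
Variable R : realType.
Notation C := R[i].
Variables (f : C -> C) (p q : {poly C}) (n : nat).
Hypothesis q0 : q != 0.
Hypothesis fE : forall z, q.[z] != 0 -> f z = p.[z] / q.[z].
Hypotheses (sp : (size p <= n.+1)%N) (sq : (size q <= n.+1)%N).

Local Notation T := (jpoly (2 * n) (q * conj_poly q)).

Lemma calR_frac z : z != 0 -> T.[z] != 0 ->
  calR f z = (jpoly (2 * n) (p * conj_poly p)).[z] / T.[z].
Proof.
move=> z0; rewrite !horner_jpoly_mul_conj// !mulf_eq0 !negb_or conjC_eq0.
move=> /and3P[zn qz qz']; rewrite /calR /ratR1 conj_joukowski !fE//.
rewrite rmorphM fmorphV /=; field.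
by rewrite zn qz conjC_eq0 qz'.
Qed.

(** Comparing the local form of [calR] at [a] with its global fraction over T gives p' T = (z - a)^k
    q' P, where p'(a) != 0. Cancellation in [calR] can only lower k. *)
Lemma calR_pole_dvd a : ('X - a%:P) ^+ pole_order (calR f) a %| T.
Proof.
have [->|k0] := posnP (pole_order (calR f) a); first by rewrite expr0 dvd1p.
have [p' [q' [s [qa' pa' cE]]]] := pole_orderP k0.
set k := pole_order _ a in k0 pa' cE *.
have q0' : q' != 0 by apply: contraNneq qa' => ->; rewrite horner0.
have T0 : T != 0 by rewrite jpoly_eq0 ?size_mul_conj_le// mulf_neq0// conj_poly_eq0.
(* The factor ['X] excludes z = 0, where [calR_frac] does not apply. *)
have d0 : 'X * ('X - a%:P) * (q' * T) != 0.
  by rewrite !mulf_neq0 ?polyXsubC_eq0 ?polyX_eq0.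
have [r dr] := nonroot_off d0.
have E : p' * T = ('X - a%:P) ^+ k * (q' * jpoly (2 * n) (p * conj_poly p)).
  apply: (@poly_eq_off _ _ _ (r ++ s)) => z.
  rewrite mem_cat negb_or => /andP[/dr + /cE].
  rewrite !hornerM hornerX hornerXsubC !mulf_eq0 !negb_or.
  move=> /andP[/andP[z0 za] /andP[qz Tz]]; rewrite calR_frac// => /eqP.
  rewrite eqr_div ?mulf_neq0 ?expf_neq0// => /eqP H.
  by rewrite horner_exp hornerXsubC mulrA [RHS]mulrC H.
have cop : coprimep (('X - a%:P) ^+ k) p'.
  apply/Pdiv.ClosedField.coprimepP => x; rewrite rootE horner_exp expf_eq0 => /andP[_].
  by rewrite hornerXsubC subr_eq0 => /eqP ->; exact: pa'.
by rewrite -(Gauss_dvdpr _ cop) E dvdp_mulr.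
Qed.

Lemma conj_poly_mul_conj : conj_poly (q * conj_poly q) = q * conj_poly q.
Proof.
rewrite {1}/conj_poly rmorphM/= mulrC; congr (_ * _).
by apply/polyP => i; rewrite !coef_map/= conjCK.
Qed.

(** The sum condition makes the number of listed poles equal to the formal degree 2n of q conj(q),
    as [jpoly_blaschke_factor] requires. *)
Lemma calR_factorization (nu : nat) (z_ : 'I_nu -> C) (n_ : 'I_nu -> nat) :
  injective z_ -> (forall k, `|z_ k| < 1) ->
  (forall k, n_ k = pole_order (calR f) (z_ k)) -> (\sum_(k < nu) n_ k = 2 * n)%N ->
  exists2 c, c != 0 &
    T = c *: (blaschke_num (zseq z_ n_) * blaschke_den (zseq z_ n_)).
Proof.
move=> z_inj z1 nE ns; have ss : size (zseq z_ n_) = (2 * n)%N by rewrite size_zseq.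
rewrite -ss; apply: jpoly_blaschke_factor.
- by move=> _ /mem_zseq [k ->].
- by rewrite ss size_mul_conj_le.
- exact: conj_poly_mul_conj.
- by rewrite mulf_neq0// conj_poly_eq0.
rewrite ss blaschke_num_zseq -big_enum /=; apply: prod_XsubC_exp_dvd => //.
  exact: enum_uniq.
by move=> k _; rewrite nE; exact: calR_pole_dvd.
Qed.

End CalR.

(** * Restriction to the unit circle and the two quadrature formulas *)

Section UnitCircle.
Variable R : realType.
Notation C := R[i].
Implicit Types w : C.

Lemma joukowski_unit w : `|w| = 1 -> joukowski w = (complex.Re w)%:C.
Proof.
move=> w1; have w0 : w != 0 by rewrite -normr_gt0 w1.
rewrite /joukowski ReJ_add; congr ((_ + _) / _).
by rewrite -[w^-1]mul1r -(expr1n _ 2) -w1 sqr_normc mulrAC divff// mul1r.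
Qed.

Lemma joukowski_unit_itv w : `|w| = 1 -> -1 <= joukowski w <= 1.
Proof.
move=> w1; rewrite joukowski_unit// -[1](rmorph1 (real_complex R)) -rmorphN !lecR -ler_norml.
by apply: Re_norm_le; rewrite w1 rmorph1.
Qed.

End UnitCircle.

Theorem theorem2p4 (R : realType) (f : R[i] -> R[i]) (n : nat)
    (f_rat : ratfun f) (f_deg : ratdegree f = n)
    (f_poles : forall x : R, -1 <= x <= 1 -> pole_order f x%:C = 0%N)
    (nu : nat) (z_ : 'I_nu -> R[i]) (n_ : 'I_nu -> nat)
    (z_inj : injective z_)
    (z_poles : forall a : R[i],
       (Normc.normc a < 1 /\ (0 < pole_order (calR f) a)%N) <->
       exists k : 'I_nu, a = z_ k)
    (n_mult : forall k : 'I_nu, n_ k = pole_order (calR f) (z_ k))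
    (n_sum : (\sum_(k < nu) n_ k = 2 * n)%N)
    (phi : R) :
  (exists zeta : (2 * n + 1).-tuple R[i],
    [/\ roots_of_eq (blaschke0 z_ n_) phi zeta,
        forall w, w \in zeta -> -1 <= joukowski w <= 1,
        cintegrable `[-1, 1] (fun x => f x%:C * (omega x)%:C) &
        cintegral `[-1, 1] (fun x => f x%:C * (omega x)%:C) =
          pi%:C * \sum_(k < 2 * n + 1)
            f (joukowski (tnth zeta k)) / ((mu0 z_ n_ (tnth zeta k))%:C + 1)])
  /\
  (forall m : nat, (0 < m)%N ->
   exists zeta : (2 * n * m + 1).-tuple R[i],
    [/\ roots_of_eq (fun w => blaschke0 z_ n_ w ^+ m) phi zeta,
        (@lebesgue_measure R).-integrable `[-1, 1]
          (fun x => (Normc.normc (f x%:C) ^+ (2 * m) * omega x)%:E) &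
        \int[@lebesgue_measure R]_(x in `[-1, 1])
            (Normc.normc (f x%:C) ^+ (2 * m) * omega x) =
          pi * \sum_(k < 2 * n * m + 1)
            Normc.normc (f (joukowski (tnth zeta k))) ^+ (2 * m)
              / (m%:R * mu0 z_ n_ (tnth zeta k) + 1)]).
Proof.
have [p [q [cpq q0 fE]]] := f_rat.
have := ratdegree_frac_ge cpq q0 fE; rewrite f_deg geq_max => /andP[sp sq].
have {}sp : (size p <= n.+1)%N by rewrite (leq_trans (leqSpred _)).
have {}sq : (size q <= n.+1)%N by rewrite (leq_trans (leqSpred _)).
have normE (w : R[i]) : `|w| = (Normc.normc w)%:C by [].
have z1 k : `|z_ k| < 1.
  rewrite normE -[1](rmorph1 (real_complex R)) ltcR.
  by have [] := (z_poles (z_ k)).2 (ex_intro _ k erefl).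
have [c c0 TE] := calR_factorization q0 fE sp sq z_inj z1 n_mult n_sum.
pose s m := zseq z_ (fun k => n_ k * m)%N.
have s1 m : {in s m, forall a, `|a| < 1} by move=> _ /mem_zseq [k ->].
have s1' : {in zseq z_ n_, forall a, `|a| < 1} by move=> _ /mem_zseq [k ->].
have ss : size (zseq z_ n_) = (2 * n)%N by rewrite size_zseq.
have ssm m : size (s m) = (2 * n * m)%N by rewrite size_zseq -big_distrl /= n_sum.
(* T = c S D, and neither S nor D vanishes on the circle. *)
have nonpole z : `|z| = 1 -> q.[joukowski z] != 0.
  move=> zn; have z0 : z != 0 by rewrite -normr_gt0 zn.
  have : (jpoly (2 * n) (q * conj_poly q)).[z] != 0.
    rewrite TE hornerZ hornerM !mulf_neq0//.
      by apply: blaschke_num_neq0 => //; rewrite zn.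
    by apply: blaschke_den_neq0 => //; rewrite zn.
  by rewrite horner_jpoly_mul_conj// !mulf_eq0 !negb_or => /and3P[].
(* Taken with (u, v) = (p, q) this represents f on the circle, and with (p, p) it represents
   |f|^2. *)
have circle (u v : {poly R[i]}) z : (size u <= n.+1)%N -> (size v <= n.+1)%N -> `|z| = 1 ->
    u.[joukowski z] * (v.[joukowski z])^* / (q.[joukowski z] * (q.[joukowski z])^*) =
    (c^-1 *: jpoly (2 * n) (u * conj_poly v)).[z] /
      ((blaschke_num (zseq z_ n_)).[z] * (blaschke_den (zseq z_ n_)).[z]).
  move=> su sv zn; have z0 : z != 0 by rewrite -normr_gt0 zn.
  have JJ : (joukowski z)^* = joukowski z.
    by rewrite joukowski_unit//; exact: conjc_real.
  have := congr1 (horner^~ z) TE; rewrite hornerZ hornerM.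
  rewrite hornerZ !horner_jpoly_mul_conj// JJ => E.
  have q1 := nonpole z zn.
  have -> : (blaschke_num (zseq z_ n_)).[z] * (blaschke_den (zseq z_ n_)).[z] =
     c^-1 * (z ^+ (2 * n) * (q.[joukowski z] * (q.[joukowski z])^*)).
    by rewrite E mulKf.
  by field; rewrite c0 expf_neq0 ?conjC_eq0 ?q1.
split.
  have [r [rootr sr r1 rE]] := roots_of_eq_zseq phi s1'.
  rewrite ss in sr.
  have sr' : size r == (2 * n + 1)%N by rewrite sr addn1.
  exists (Tuple sr').
  have [] := @integral_blaschke_quadrature R (zseq z_ n_) (expi phi)
      (c^-1 *: jpoly (2 * n) (p * conj_poly q)) (fun x => f x%:C) r
      s1' (norm_expi phi) _ _ (proj1 rootr) rE.
  - by rewrite (leq_trans (size_scale_leq _ _))// (leq_trans (size_jpoly _ _))// ss.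
  - move=> z zn; rewrite -circle// -joukowski_unit// fE ?nonpole//.
    by field; rewrite conjC_eq0 nonpole.
  move=> Ig Eg; split=> //.
    by move=> w /r1; exact: joukowski_unit_itv.
  rewrite Eg -(big_tuple _ _ (Tuple sr') xpredT (fun w =>
    f (joukowski w) / ((mu0 z_ n_ w)%:C + 1))).
  congr (_ * _); apply: eq_big_seq => w wr.
  by rewrite mu0_poisson_sum joukowski_unit ?r1.
move=> m m0.
have [r [rootr sr r1 rE]] := roots_of_eq_zseq phi (s1 m).
rewrite -/(s m) ssm in sr.
have sr' : size r == (2 * n * m + 1)%N by rewrite sr addn1.
exists (Tuple sr').
(* The real integrand is embedded in the complex numbers to fit the quadrature; the result is read
   off from the real part. *)
pose g x : R[i] := (Normc.normc (f x%:C) ^+ (2 * m))%:C.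
have gE (x : R) : g x = (f x%:C * (f x%:C)^*) ^+ m.
  by rewrite /g rmorphXn /= exprM -normE normCK.
have [] := @integral_blaschke_quadrature R (s m) (expi phi)
    ((c^-1 *: jpoly (2 * n) (p * conj_poly p)) ^+ m) g r
    (s1 m) (norm_expi phi) _ _ (proj1 rootr) rE.
(* The m-th power has degree at most 4nm, twice the length 2nm of the list [s m]. *)
- apply: leq_trans (size_poly_exp_leq _ _) _; rewrite ssm ltnS.
  rewrite doubleMl leq_mul2r; apply/orP; right.
  rewrite -subn1 leq_subLR add1n (leq_trans (size_scale_leq _ _))//; exact: size_jpoly.
- move=> z zn; rewrite gE horner_exp /s blaschke_num_zseq_exp blaschke_den_zseq_exp.
  rewrite !horner_exp -exprMn -expr_div_n -circle// -joukowski_unit// fE ?nonpole//.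
  congr (_ ^+ m); rewrite rmorphM fmorphV /=.
  by field; rewrite conjC_eq0 nonpole.
move=> [IRe _] Eg.
have ReM (x : R) : complex.Re (g x * (omega x)%:C) = Normc.normc (f x%:C) ^+ (2 * m) * omega x.
  by rewrite /g -rmorphM.
split.
- have [ur rr] := rootr; split=> // w; rewrite blaschke0_exp; exact: rr.
- by move: IRe; congr (_.-integrable _ _); apply/funext => x; rewrite ReM.
have -> : \int[@lebesgue_measure R]_(x in `[-1, 1]) (Normc.normc (f x%:C) ^+ (2 * m) * omega x) =
    complex.Re (cintegral `[-1, 1] (fun x => g x * (omega x)%:C)).
  by apply: eq_Rintegral => x _; rewrite ReM.
rewrite Eg -(big_tuple _ _ (Tuple sr') xpredT (fun w =>
   Normc.normc (f (joukowski w)) ^+ (2 * m) / (m%:R * mu0 z_ n_ w + 1))).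
rewrite (_ : \sum_(x <- r) _ = (\sum_(w <- r) Normc.normc (f (joukowski w)) ^+ (2 * m)
   / (m%:R * mu0 z_ n_ w + 1))%:C); first by rewrite -rmorphM.
rewrite rmorph_sum; apply: eq_big_seq => w wr.
rewrite mu0_mul /= rmorphM fmorphV rmorphD rmorph1. 
rewrite -[poisson_sum (s m) w]mu0_poisson_sum /g.
by rewrite joukowski_unit ?r1.
Qed.
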